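(* Let $d\ge 2$ and let $\xi_1,\xi_2,\dots$ be independent random points, each uniformly distributed on the $d$-dimensional unit ball $B=\{x\in\mathbb{R}^d:\|x\|\le 1\}$. Let $P_n$ be the convex hull of $\{\xi_1,\dots,\xi_n\}$. Then for every $t>0$, as $n\to\infty$, $$\mathbf{P}\left\{n^{\frac{4}{d+3}}(2-\operatorname{diam}P_n)\le t\right\}\;\to\; 1-\exp\left\{-\frac{2^d\, d\,\Gamma(\frac d2+1)}{\sqrt{\pi}\,(d+1)(d+3)\,\Gamma(\frac{d+1}{2})}\,t^{\frac{d+3}{2}}\right\}.$$
   Context: $\|\cdot\|$ is the Euclidean norm; $\operatorname{diam}(F)=\sup_{x,y\in F}\|x-y\|$ for $F\subset\mathbb{R}^d$; $\Gamma(x)=\int_0^\infty s^{x-1}e^{-s}\,ds$ is the Gamma function. *)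

(* Defs.v *)
From HB Require Import structures.
From mathcomp Require Import all_boot all_order all_algebra finmap.
From mathcomp Require Import all_classical all_reals all_analysis.

Set Implicit Arguments.
Unset Strict Implicit.
Unset Printing Implicit Defensive.

Import Order.TTheory GRing.Theory Num.Theory.
Import numFieldNormedType.Exports.

Local Open Scope classical_set_scope.
Local Open Scope ring_scope.

(* The points of R^n are the row vectors 'rV[R]_n. Beware that the norm that
   the library puts on them is the sup norm; the Euclidean norm is [enorm]. *)

(* 'rV[R]_n carries the sigma-algebra generated by the coordinate maps, i.e.
   the Borel one; this is the analogue of the library's instance on tuples. *)
Definition rV_display : measure_display. Proof. exact: default_measure_display. Qed.

Section measurable_rV.
Context {R : realType} (n : nat).

Definition coord_rV (i : 'I_n) (x : 'rV[R]_n) : R := x ord0 i.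

Let rV_set0 : g_sigma_preimage coord_rV set0.
Proof. exact: sigma_algebra0. Qed.

Let rV_setC A : g_sigma_preimage coord_rV A -> g_sigma_preimage coord_rV (~` A).
Proof. exact: sigma_algebraC. Qed.

Let rV_bigcup (F : _^nat) : (forall i, g_sigma_preimage coord_rV (F i)) ->
  g_sigma_preimage coord_rV (\bigcup_i (F i)).
Proof. exact: sigma_algebra_bigcup. Qed.

HB.instance Definition _ := @isMeasurable.Build rV_display
  'rV[R]_n (g_sigma_preimage coord_rV) rV_set0 rV_setC rV_bigcup.

End measurable_rV.

Lemma measurable_coord_rV (R : realType) n (i : 'I_n) :
  measurable_fun [set: 'rV[R]_n] (coord_rV i).
Proof.
move=> _ Y mY; rewrite setTI; apply: sub_sigma_algebra => /=.
rewrite -bigcup_seq/=; exists i => /=; first by rewrite mem_index_enum.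
by exists Y => //; rewrite setTI.
Qed.

Lemma measurable_fun_rVP (R : realType) d (T : measurableType d) n
    (f : T -> 'rV[R]_n) :
  measurable_fun [set: T] f <->
  forall i, measurable_fun [set: T] (coord_rV i \o f).
Proof.
split=> [mf i|mf].
  by apply: measurableT_comp mf; exact: measurable_coord_rV.
apply: (@measurability _ _ _ _ _ _
  (\big[setU/set0]_(i < n) preimage_set_system setT (@coord_rV R n i) measurable)).
  by [].
move=> _ [A + <-]; rewrite -bigcup_seq/= => -[i _ [B mB <-]].
by rewrite setTI; have := mf i measurableT B mB.
Qed.

Section lebesgue_rV.
Local Open Scope ereal_scope.
Context {R : realType}.

Definition cons_rV n (xv : measurableTypeR R * 'rV[R]_n) : 'rV[R]_n.+1 :=
  row_mx (const_mx xv.1 : 'rV[R]_1) xv.2.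

Lemma cons_rV0 n (xv : measurableTypeR R * 'rV[R]_n) :
  cons_rV xv ord0 ord0 = xv.1.
Proof.
rewrite /cons_rV (_ : (ord0 : 'I_n.+1) = lshift n (ord0 : 'I_1)).
  by rewrite (@row_mxEl _ 1 1 n) mxE.
exact/val_inj.
Qed.

Lemma cons_rVS n (xv : measurableTypeR R * 'rV[R]_n) i :
  cons_rV xv ord0 (lift ord0 i) = xv.2 ord0 i.
Proof.
rewrite /cons_rV (_ : lift ord0 i = rshift 1 i); last exact/val_inj.
by rewrite (@row_mxEr _ 1 1 n).
Qed.

Lemma measurable_cons_rV n : measurable_fun setT (@cons_rV n).
Proof.
apply/measurable_fun_rVP => i; case: (unliftP ord0 i) => [j|] ->.
  rewrite (_ : _ \o _ = coord_rV j \o snd).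
    by apply: measurableT_comp; [exact: measurable_coord_rV|].
  by apply/funext => xv; rewrite /= /coord_rV cons_rVS.
rewrite (_ : _ \o _ = fst) //.
by apply/funext => xv; rewrite /= /coord_rV cons_rV0.
Qed.

Lemma measurable_behead_rV n :
  measurable_fun setT
    (fun x : 'rV[R]_n.+1 => (\row_j x ord0 (lift ord0 j) : 'rV[R]_n)).
Proof.
apply/measurable_fun_rVP => i.
rewrite (_ : _ \o _ = coord_rV (lift ord0 i)); first exact: measurable_coord_rV.
by apply/funext => x; rewrite /= /coord_rV mxE.
Qed.

Section step.
Variables (n : nat) (mu : {sigma_finite_measure set 'rV[R]_n -> \bar R}).

Definition lebesgue_rV_step : set 'rV[R]_n.+1 -> \bar R :=
  pushforward (@lebesgue_measure R \x mu) (@cons_rV n).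

Let mcons := @measurable_cons_rV n.

Let step0 : lebesgue_rV_step set0 = 0.
Proof. exact: measure0. Qed.

Let step_ge0 A : 0 <= lebesgue_rV_step A.
Proof. exact: measure_ge0. Qed.

Let step_sigma_additive : semi_sigma_additive lebesgue_rV_step.
Proof. exact: measure_semi_sigma_additive. Qed.

HB.instance Definition _ := isMeasure.Build _ _ _ lebesgue_rV_step
  step0 step_ge0 step_sigma_additive.

Let step_sigma_finite : sigma_finite setT lebesgue_rV_step.
Proof.
have /sigma_finiteP[F [TF ndF Foo]] := sigma_finiteT (@lebesgue_measure R).
have /sigma_finiteP[G [TG ndG Goo]] := sigma_finiteT mu.
pose split_rV (x : 'rV[R]_n.+1) : measurableTypeR R * 'rV[R]_n :=
  (coord_rV ord0 x, \row_j x ord0 (lift ord0 j)).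
have cons_rVK : cancel (@cons_rV n) split_rV.
  move=> [x v]; rewrite /split_rV /coord_rV cons_rV0; congr pair.
  by apply/rowP => j; rewrite mxE cons_rVS.
have msplit : measurable_fun setT split_rV.
  apply: (measurable_fun_pair (f := coord_rV ord0 : _ -> measurableTypeR R)).
    exact: measurable_coord_rV.
  exact: measurable_behead_rV.
exists (fun k => split_rV @^-1` (F k `*` G k)).
  rewrite -preimage_bigcup -[LHS](preimage_setT split_rV); congr (_ @^-1` _).
  rewrite -setXTT TF TG; apply/seteqP; split=> -[x y] /=; last first.
    by move=> [k _ [/= ? ?]]; split; exists k.
  move=> [[k _ Fkx] [l _ Gly]]; exists (maxn k l) => //; split => /=.
    by move: x Fkx; exact/subsetPset/ndF/leq_maxl.
  by move: y Gly; exact/subsetPset/ndG/leq_maxr.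
move=> k; have [mF Fk] := Foo k; have [mG Gk] := Goo k; split.
  by rewrite -[X in measurable X]setTI; apply: msplit => //; exact: measurableX.
rewrite /lebesgue_rV_step /pushforward -comp_preimage.
rewrite (_ : split_rV \o _ = id); last by apply/funext => xv /=; rewrite cons_rVK.
by rewrite product_measure1E// lte_mul_pinfty// ge0_fin_numE.
Qed.

HB.instance Definition _ := Measure_isSigmaFinite.Build _ _ _
  lebesgue_rV_step step_sigma_finite.

End step.

(* Lebesgue measure on R^n, as the iterated product of n copies of the
   one-dimensional one; R^0 is a point, of mass 1. *)
Fixpoint lebesgue_rV n : {sigma_finite_measure set 'rV[R]_n -> \bar R} :=
  match n with
  | 0 => \d_(0%R : 'rV[R]_0)
  | n'.+1 => lebesgue_rV_step (lebesgue_rV n')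
  end.

Lemma lebesgue_rV_box n (A : 'I_n -> set (measurableTypeR R)) :
  (forall i, measurable (A i)) ->
  lebesgue_rV n [set x | forall i, A i (x ord0 i)] =
  \prod_(i < n) lebesgue_measure (A i).
Proof.
elim: n A => [|n ih] A mA.
  rewrite big_ord0 /= diracE (_ : _ \in _) // inE /=.
  by move=> [].
rewrite big_ord_recl -ih => [|i]; last exact: mA.
have mB : measurable
    [set x : 'rV[R]_n | forall i, A (lift ord0 i) (x ord0 i)].
  rewrite [X in measurable X](_ : _ = \bigcap_(i in setT)
      (coord_rV i @^-1` A (lift ord0 i))).
    apply: fin_bigcap_measurable => // i _.
    rewrite -[X in measurable X]setTI.
    by apply: measurable_coord_rV => //; exact: mA.
  by apply/seteqP; split => x /= Ax i; [move=> _|]; exact: Ax.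
rewrite -product_measure1E//.
rewrite /= /lebesgue_rV_step /pushforward; congr (product_measure1 _ _ _).
apply/seteqP; split => -[x v] /=.
  move=> H; split; first by have := H ord0; rewrite cons_rV0.
  by move=> i; have := H (lift ord0 i); rewrite cons_rVS.
move=> [Ax Av] i; case: (unliftP ord0 i) => [j|] ->.
  by rewrite cons_rVS.
by rewrite cons_rV0.
Qed.

End lebesgue_rV.

Section euclidean.
Context {R : realType} {n : nat}.
Implicit Types (x : 'rV[R]_n) (A : set 'rV[R]_n).

Definition enorm x : R := Num.sqrt (\sum_(i < n) x ord0 i ^+ 2).

Definition unit_ball : set 'rV[R]_n := [set x | enorm x <= 1].

Definition diam A : R := sup [set enorm (x - y) | x in A & y in A].

Definition convex_hull A : set 'rV[R]_n :=
  smallest (@convex_set R 'rV[R]_n) A.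

End euclidean.

Section random.
Context {R : realType} d d' (T : measurableType d) (T' : measurableType d').
Variable P : probability T R.
Local Open Scope ereal_scope.

Definition mutually_independent (I : choiceType) (X : I -> {RV P >-> T'}) :=
  forall (J : {fset I}) (A : I -> set T'),
    (forall i, i \in J -> measurable (A i)) ->
    P (\bigcap_(i in [set` J]) X i @^-1` A i) =
    \prod_(i <- J) P (X i @^-1` A i).

Definition uniform_on n (B : set 'rV[R]_n) (X : {RV P >-> 'rV[R]_n}) :=
  forall A, measurable A ->
    distribution P X A = lebesgue_rV n (A `&` B) / lebesgue_rV n B.

End random.

Definition Gamma {R : realType} (x : R) : R :=
  \int[@lebesgue_measure R]_(s in `]0, +oo[) (s `^ (x - 1) * expR (- s)).

(* Main.v *)
Require Import Defs.
From HB Require Import structures.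
From mathcomp Require Import all_boot all_order all_algebra finmap.
From mathcomp Require Import all_classical all_reals all_analysis.
From mathcomp Require Import measurable_realfun.
From mathcomp Require Import ring lra.

(** Put [s = t / n ^ (4 / (d + 3))]; the event is that the hull has diameter at
    least [2 - s]. Since balls are convex, the diameter of a hull is the largest
    distance of two of the points ([diam_convex_hull_ge]), so the event is that
    some pair of the [n] points is far, that is, at distance at least [2 - s].

    There are about [n ^ 2 / 2] pairs, and each of them is far with a probability
    [p] of order [s ^ ((d + 3) / 2)], that is, of order [n ^ -2]: the expected
    number of far pairs converges to a limit, which is the exponent of the
    theorem. Disjoint pairs are independent. Two pairs with a common point are
    both far with probability at most [Q * p], where [Q], of order
    [s ^ ((d + 1) / 2)], bounds the probability that a random point is far from
    a given one; as [n * Q] tends to 0, these coincidences are negligible and the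
    number of far pairs is asymptotically a Poisson variable. Only its
    probability of vanishing matters, and it is obtained directly: when the
    pairs are excluded one after the other, each one multiplies the probability
    that there has been no far pair by [1 - p], up to an error that comes from
    the previous pairs with a common point ([none_of_estimate]). The total error
    is of order [n ^ 3 * Q * p], and [(1 - p) ^ (n (n - 1) / 2)] converges to the
    exponential ([cvg_no_far_pair]).

    The asymptotics of [p] is a volume computation. The pairs of points of the
    unit ball with difference [u] form a lens, made of two caps of height
    [1 - |u| / 2] ([lens_volume]); cutting the caps into slices and integrating
    over [u] first turns the volume of the far pairs into a one-dimensional
    integral ([far_pairs_volume]), which is easily bounded on both sides
    ([far_pairs_volume_bounds]). The points far from [x] lie in a cap of height
    [2 * s] opposite to [x], whence [Q] ([far_points_volume]).

    The invariance of Lebesgue measure under isometries and its behaviour under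
    dilations come from Fubini: two translation-invariant measures are
    proportional ([translation_invariant_swap]). The Gamma functions enter
    through the volumes of the unit balls of dimensions [d - 1] and [d], which
    are read off the Gaussian integral ([ball_volume_Gamma]). *)

Set Implicit Arguments.
Unset Strict Implicit.
Unset Printing Implicit Defensive.

Import Order.TTheory GRing.Theory Num.Theory.
Import numFieldNormedType.Exports.

Local Open Scope classical_set_scope.
Local Open Scope ring_scope.

(** * Measurability *)

Section image_measure.
Context d1 d2 (T1 : measurableType d1) (T2 : measurableType d2) (R : realType).
Variables (m : {measure set T1 -> \bar R}) (f : T1 -> T2).

(** The image of a measure. Unlike the term [pushforward m f], this one
    mentions the measurability of the map, from which the structure of
    measure is inferred. *)
Definition image_measure (mf : measurable_fun setT f) : set T2 -> \bar R :=
  pushforward m f.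

Hypothesis mf : measurable_fun setT f.

Let image_measure0 : (image_measure mf set0 = 0)%E.
Proof. exact: measure0. Qed.

Let image_measure_ge0 A : (0 <= image_measure mf A)%E.
Proof. exact: measure_ge0. Qed.

Let image_measure_sigma_additive : semi_sigma_additive (image_measure mf).
Proof. exact: measure_semi_sigma_additive. Qed.

HB.instance Definition _ := isMeasure.Build _ _ _ (image_measure mf)
  image_measure0 image_measure_ge0 image_measure_sigma_additive.

End image_measure.

Section measurable_linear.
Context {R : realType}.

Lemma measurable_rV_preimage d (T : measurableType d) n (f : T -> 'rV[R]_n) A :
  measurable_fun setT f -> measurable A -> measurable (f @^-1` A).
Proof. by move=> mf mA; rewrite -[X in measurable X]setTI; exact: mf. Qed.

Lemma measurable_addrV d (T : measurableType d) n (f g : T -> 'rV[R]_n) :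
  measurable_fun setT f -> measurable_fun setT g ->
  measurable_fun setT (fun x => f x + g x).
Proof.
move=> /measurable_fun_rVP mf /measurable_fun_rVP mg.
apply/measurable_fun_rVP => i.
rewrite (_ : _ \o _ = (coord_rV i \o f) \+ (coord_rV i \o g)).
  exact: measurable_funD.
by apply/funext => x; rewrite /coord_rV /= mxE.
Qed.

Lemma measurable_mulmxrV d (T : measurableType d) m n (M : 'M[R]_(m, n))
    (f : T -> 'rV[R]_m) :
  measurable_fun setT f -> measurable_fun setT (fun x => f x *m M).
Proof.
move=> /measurable_fun_rVP mf; apply/measurable_fun_rVP => i.
rewrite (_ : _ \o _ = (fun x => \sum_(j < m) (coord_rV j \o f) x * M j i)).
  by apply: measurable_sum => j; apply: measurable_funM.
by apply/funext => x; rewrite /coord_rV /= mxE.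
Qed.

Lemma measurable_scalerV d (T : measurableType d) n (a : R)
    (f : T -> 'rV[R]_n) :
  measurable_fun setT f -> measurable_fun setT (fun x => a *: f x).
Proof.
move=> /(measurable_mulmxrV a%:M); congr (measurable_fun _ _).
by apply/funext => x; rewrite mul_mx_scalar.
Qed.

Lemma measurable_opprV d (T : measurableType d) n (f : T -> 'rV[R]_n) :
  measurable_fun setT f -> measurable_fun setT (fun x => - f x).
Proof.
move=> /(measurable_scalerV (-1)); congr (measurable_fun _ _).
by apply/funext => x; rewrite scaleN1r.
Qed.

Lemma measurable_subrV d (T : measurableType d) n (f g : T -> 'rV[R]_n) :
  measurable_fun setT f -> measurable_fun setT g ->
  measurable_fun setT (fun x => f x - g x).
Proof. by move=> mf /measurable_opprV; exact: measurable_addrV. Qed.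

Lemma measurable_enorm d (T : measurableType d) n (f : T -> 'rV[R]_n) :
  measurable_fun setT f -> measurable_fun setT (fun x => enorm (f x)).
Proof.
move=> /measurable_fun_rVP mf.
apply: (measurableT_comp (f := @Num.sqrt R)).
  by apply: continuous_measurable_fun; exact: sqrt_continuous.
apply: measurable_sum => i.
by apply: (measurable_funX (f := coord_rV i \o f)).
Qed.

Lemma measurable_ler d (T : measurableType d) (f g : T -> R) :
  measurable_fun setT f -> measurable_fun setT g ->
  measurable [set x | f x <= g x].
Proof.
move=> mf mg; rewrite -[X in measurable X]setTI.
exact: measurable_fun_ler.
Qed.

End measurable_linear.

Section product_measure_sets.
Local Open Scope ereal_scope.
Context d1 d2 (T1 : measurableType d1) (T2 : measurableType d2) (R : realType).

Lemma product_measure_set1 (m1 : {measure set T1 -> \bar R})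
  (m2 : {sigma_finite_measure set T2 -> \bar R}) A :
  (m1 \x m2) A = \int[m1]_x m2 [set y | A (x, y)].
Proof.
apply: eq_integral => x _ /=; congr (m2 _).
by rewrite /xsection; apply/seteqP; split => y /=; rewrite inE.
Qed.

Lemma product_measure_set2 (m1 : {sigma_finite_measure set T1 -> \bar R})
  (m2 : {sigma_finite_measure set T2 -> \bar R}) A : measurable A ->
  (m1 \x m2) A = \int[m2]_y m1 [set x | A (x, y)].
Proof.
move=> mA.
rewrite (_ : (m1 \x m2) A = \int[m1]_x fubini_F m2 (EFin \o \1_A) x).
  rewrite (indic_fubini_tonelli m1 m2 mA) indic_fubini_tonelli_GE//.
  apply: eq_integral => y _ /=; congr (m1 _).
  by rewrite /ysection; apply/seteqP; split => x /=; rewrite inE.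
by rewrite indic_fubini_tonelli_FE.
Qed.

End product_measure_sets.

(** * Translation invariance of Lebesgue measure *)

Section translation.
Local Open Scope ereal_scope.
Context {R : realType}.

Lemma lebesgue_measure_translate (a : R) (A : set (measurableTypeR R)) :
  measurable A ->
  lebesgue_measure ((fun x => (x + a)%R) @^-1` A) = lebesgue_measure A.
Proof.
move=> mA; have mf : measurable_fun setT (fun x : measurableTypeR R =>
    (x + a)%R : measurableTypeR R) by exact: measurable_funD.
rewrite -[LHS]/(pushforward (@lebesgue_measure R) _ A).
rewrite -(lebesgue_measure_unique (mu := image_measure _ mf))// => X.
move=> [[x y] _ <-]; rewrite /pushforward /=.
rewrite [X in _ = lebesgue_measure X](_ : _ = `](x - a), (y - a)]%classic%R).
  rewrite !lebesgue_measure_itv /= !lte_fin ltrD2r.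
  by case: ifP => // _; rewrite -!EFinB; congr EFin; ring.
by apply/seteqP; split => z /=; rewrite !in_itv /= ltrBlDr lerBrDr.
Qed.

Lemma product_measure_invariant d1 d2 (T1 : measurableType d1)
    (T2 : measurableType d2) (m1 : {sigma_finite_measure set T1 -> \bar R})
    (m2 : {sigma_finite_measure set T2 -> \bar R}) (f1 : T1 -> T1)
    (f2 : T2 -> T2) :
  measurable_fun setT f1 -> measurable_fun setT f2 ->
  (forall A, measurable A -> m1 (f1 @^-1` A) = m1 A) ->
  (forall A, measurable A -> m2 (f2 @^-1` A) = m2 A) ->
  forall A, measurable A ->
    (m1 \x m2) ((fun xy => (f1 xy.1, f2 xy.2)) @^-1` A) = (m1 \x m2) A.
Proof.
move=> mf1 mf2 H1 H2 A mA.
have mf : measurable_fun setT (fun xy : T1 * T2 => (f1 xy.1, f2 xy.2)).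
  by apply: measurable_fun_pair => /=; exact: measurableT_comp.
rewrite [RHS](product_measure_unique (m' := image_measure (m1 \x m2) mf))//.
move=> B C mB mC; rewrite /pushforward /=.
rewrite -(H1 _ mB) -(H2 _ mC) -product_measure1E //.
- by rewrite -[X in measurable X]setTI; exact: mf1.
- by rewrite -[X in measurable X]setTI; exact: mf2.
Qed.

Lemma lebesgue_rV_translate n (v : 'rV[R]_n) A : measurable A ->
  lebesgue_rV n ((fun x => (x + v)%R) @^-1` A) = lebesgue_rV n A.
Proof.
elim: n v A => [v A mA|n ih v A mA].
  congr (lebesgue_rV 0 _); apply/seteqP; split => x /=;
  by rewrite (thinmx0 (x + v)%R) (thinmx0 x).
pose w : 'rV[R]_n := (\row_j v ord0 (lift ord0 j))%R.
have mA' : measurable (@cons_rV R n @^-1` A).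
  by apply: measurable_rV_preimage => //; exact: measurable_cons_rV.
have mw : measurable_fun setT (fun x : 'rV[R]_n => (x + w)%R).
  by apply: measurable_addrV.
have mt : measurable_fun setT
    (fun x : measurableTypeR R => (x + v ord0 ord0)%R : measurableTypeR R).
  exact: measurable_funD.
rewrite /= /lebesgue_rV_step /pushforward.
rewrite -[RHS](product_measure_invariant mt mw)//; last 2 first.
- by move=> B mB; exact: lebesgue_measure_translate.
- by move=> B mB; exact: ih.
congr (product_measure1 _ _ _); apply/seteqP; split => -[x y] /=;
  rewrite (_ : cons_rV (x, y) + v = cons_rV (x + v ord0 ord0, y + w))%R//;
  apply/rowP => i; rewrite mxE; case: (unliftP ord0 i) => [j|] ->;
  by rewrite ?cons_rVS ?cons_rV0 /= ?mxE.
Qed.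

End translation.

Section haar.
Local Open Scope ereal_scope.
Context {R : realType} (n : nat).
Variable nu : {sigma_finite_measure set 'rV[R]_n -> \bar R}.
Hypothesis nu_translate : forall (v : 'rV[R]_n) (A : set 'rV[R]_n),
  measurable A ->
  nu ((fun x => (x + v)%R) @^-1` A) = nu A.
Local Notation lam := (@lebesgue_rV R n).

(** Translating [x] by [y] exchanges the set of the [(x, y)] with [A x] and
    [B (x + y)] and the set of those with [A (x - y)] and [B x]; their slices
    have the two sides as integrals. So two translation-invariant measures are
    proportional, and one symmetric set [A] determines the factor. *)
Lemma translation_invariant_swap (A B : set 'rV[R]_n) :
  measurable A -> measurable B ->
  lam A * nu B = nu (-%R @^-1` A) * lam B.
Proof.
move=> mA mB.
have mfst : measurable_fun setT (fst : 'rV[R]_n * 'rV[R]_n -> _) by [].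
have msnd : measurable_fun setT (snd : 'rV[R]_n * 'rV[R]_n -> _) by [].
have mN : measurable (-%R @^-1` A).
  by apply: measurable_rV_preimage => //; exact: measurable_opprV.
pose E := [set xy : 'rV[R]_n * 'rV[R]_n | A xy.1 /\ B (xy.1 + xy.2)%R].
pose F := [set xy : 'rV[R]_n * 'rV[R]_n | A (xy.1 - xy.2)%R /\ B xy.1].
have mE : measurable E.
  apply: measurableI; first exact: (measurable_rV_preimage mfst).
  by apply: (measurable_rV_preimage _ mB); exact: measurable_addrV.
have mF : measurable F.
  apply: measurableI; last exact: (measurable_rV_preimage mfst).
  by apply: (measurable_rV_preimage _ mA); exact: measurable_subrV.
transitivity ((lam \x nu) E).
  rewrite product_measure_set1.
  rewrite (eq_integral (fun x => (\1_A x)%:E * nu B)).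
    by rewrite ge0_integralZr ?integral_indic ?setIT//; exact: measurableT_comp.
  move=> x _; rewrite indicE; have [xA|xA] := boolP (x \in A).
    rewrite mul1e -(nu_translate x mB); congr (nu _).
    apply/seteqP; split => y /=; rewrite (addrC y x); first by case.
    by split => //; exact: set_mem.
  rewrite mul0e (_ : [set y | _] = set0) ?measure0//.
  by apply/seteqP; split => y //= -[]; move=> /mem_set; rewrite (negPf xA).
transitivity ((lam \x nu) F).
  rewrite (product_measure_set2 _ _ mE) (product_measure_set2 _ _ mF).
  apply: eq_integral => y _.
  rewrite -[RHS](lebesgue_rV_translate y).
    by congr (lam _); apply/seteqP; split => x; rewrite /E /F /= addrK.
  have mAy : measurable ((fun x : 'rV[R]_n => (x - y)%R) @^-1` A).
    by apply: measurable_rV_preimage mA; exact: measurable_subrV.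
  exact: (measurableI _ _ mAy mB).
rewrite product_measure_set1.
rewrite (eq_integral (fun x => (\1_B x)%:E * nu (-%R @^-1` A))).
  rewrite ge0_integralZr ?integral_indic ?setIT//; last exact: measurableT_comp.
  by rewrite muleC.
move=> x _; rewrite indicE; have [xA|xA] := boolP (x \in B).
  rewrite mul1e -(nu_translate (- x)%R mN); congr (nu _).
  apply/seteqP; split => y /=; rewrite opprB; first by case.
  by split => //; exact: set_mem.
rewrite mul0e (_ : [set y | _] = set0) ?measure0//.
by apply/seteqP; split => y //= -[_]; move=> /mem_set; rewrite (negPf xA).
Qed.

End haar.

(** * Euclidean structure *)

Section euclidean_structure.
Context {R : realType} {n : nat}.
Implicit Types (x y z u v w : 'rV[R]_n) (a : R).

Definition dotv x y : R := \sum_(i < n) x ord0 i * y ord0 i.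

Lemma dotvC x y : dotv x y = dotv y x.
Proof. by apply: eq_bigr => i _; rewrite mulrC. Qed.

Lemma dotvDl x y z : dotv (x + y) z = dotv x z + dotv y z.
Proof. by rewrite -[RHS]big_split; apply: eq_bigr => i _; rewrite mxE mulrDl. Qed.

Lemma dotvZl a x y : dotv (a *: x) y = a * dotv x y.
Proof. by rewrite [RHS]mulr_sumr; apply: eq_bigr => i _; rewrite mxE mulrA. Qed.

Lemma dotvNl x y : dotv (- x) y = - dotv x y.
Proof. by rewrite -scaleN1r dotvZl mulN1r. Qed.

Lemma dotvBl x y z : dotv (x - y) z = dotv x z - dotv y z.
Proof. by rewrite dotvDl dotvNl. Qed.

Lemma dotvDr x y z : dotv x (y + z) = dotv x y + dotv x z.
Proof. by rewrite !(dotvC x) dotvDl. Qed.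

Lemma dotvZr a x y : dotv x (a *: y) = a * dotv x y.
Proof. by rewrite !(dotvC x) dotvZl. Qed.

Lemma dotvNr x y : dotv x (- y) = - dotv x y.
Proof. by rewrite !(dotvC x) dotvNl. Qed.

Definition dotvE := (dotvDl, dotvDr, dotvNl, dotvNr, dotvZl, dotvZr).

Lemma dotvv_ge0 x : 0 <= dotv x x.
Proof. by apply: sumr_ge0 => i _; rewrite -expr2 sqr_ge0. Qed.

Lemma dotvv_eq0 x : (dotv x x == 0) = (x == 0).
Proof.
apply/eqP/eqP => [/psumr_eq0P H|->]; last first.
  by rewrite /dotv big1// => i _; rewrite mxE mul0r.
apply/rowP => i; rewrite mxE; apply/eqP.
by rewrite -[_ == 0]sqrf_eq0 expr2 H// => j _; rewrite -expr2 sqr_ge0.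
Qed.

Lemma enormE x : enorm x = Num.sqrt (dotv x x).
Proof. by congr Num.sqrt; apply: eq_bigr => i _; rewrite expr2. Qed.

Lemma sqr_enorm x : enorm x ^+ 2 = dotv x x.
Proof. by rewrite enormE sqr_sqrtr // dotvv_ge0. Qed.

Lemma enorm_ge0 x : 0 <= enorm x.
Proof. exact: sqrtr_ge0. Qed.

Lemma enorm0 : enorm (0 : 'rV[R]_n) = 0.
Proof.
have /eqP h : dotv (0 : 'rV[R]_n) 0 == 0 by rewrite dotvv_eq0.
by rewrite enormE h sqrtr0.
Qed.

Lemma enormN x : enorm (- x) = enorm x.
Proof. by rewrite !enormE dotvNl dotvNr opprK. Qed.

Lemma enormZ a x : enorm (a *: x) = `|a| * enorm x.
Proof.
by rewrite !enormE dotvZl dotvZr mulrA -expr2 sqrtrM ?sqr_ge0// sqrtr_sqr.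
Qed.

Lemma enorm_leE x a : 0 <= a -> (enorm x <= a) = (dotv x x <= a ^+ 2).
Proof. by move=> a0; rewrite -sqr_enorm ler_sqr ?nnegrE ?enorm_ge0. Qed.

Lemma le_enormE x a : 0 <= a -> (a <= enorm x) = (a ^+ 2 <= dotv x x).
Proof. by move=> a0; rewrite -sqr_enorm ler_sqr ?nnegrE ?enorm_ge0. Qed.

(** Cauchy-Schwarz. *)
Lemma dotv_le_enorm x y : dotv x y <= enorm x * enorm y.
Proof.
have [->|y0] := eqVneq y 0; first by rewrite dotvC -(scale0r x) dotvZl mul0r
  mulr_ge0 ?enorm_ge0.
have yy : 0 < dotv y y by rewrite lt0r dotvv_eq0 y0 dotvv_ge0.
rewrite (le_trans (ler_norm _))//.
rewrite -ler_sqr ?nnegrE ?mulr_ge0 ?enorm_ge0// exprMn !sqr_enorm.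
rewrite real_normK ?num_real//.
(* [y]-orthogonal component of [x], scaled by [dotv y y] to avoid divisions *)
have := dotvv_ge0 (dotv y y *: x - dotv x y *: y).
rewrite !dotvE (dotvC y x) => H; rewrite -subr_ge0 -(pmulr_rge0 _ yy).
by move: H; congr (0 <= _); ring.
Qed.

Lemma enormD x y : enorm (x + y) <= enorm x + enorm y.
Proof.
rewrite enorm_leE ?addr_ge0 ?enorm_ge0//.
rewrite !dotvE (dotvC y x).
by have := dotv_le_enorm x y; rewrite sqrrD !sqr_enorm; lra.
Qed.

Lemma enormB x y : enorm (x - y) = enorm (y - x).
Proof. by rewrite -enormN opprB. Qed.

(** The reflection exchanging [u] and [v], in the hyperplane orthogonal to
    [u - v]; for [u = v] the scalar is [0 / 0 = 0] and this is the identity. *)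
Definition reflect_swap u v x :=
  x - (2 * dotv x (u - v) / dotv (u - v) (u - v)) *: (u - v).

Lemma reflect_swapD u v : {morph reflect_swap u v : x y / x + y}.
Proof.
move=> x y; rewrite /reflect_swap dotvDl mulrDr mulrDl scalerDl opprD.
by rewrite addrACA.
Qed.

Lemma dotv_reflect_swap u v x y :
  dotv (reflect_swap u v x) (reflect_swap u v y) = dotv x y.
Proof.
rewrite /reflect_swap; move: (u - v) => w.
have [->|w0] := eqVneq w 0; first by rewrite !scaler0 !subr0.
have ww : dotv w w != 0 by rewrite dotvv_eq0.
by rewrite !dotvE (dotvC w y); field.
Qed.

Lemma reflect_swapK u v : involutive (reflect_swap u v).
Proof.
move=> x; rewrite /reflect_swap; move: (u - v) => w.
have [->|w0] := eqVneq w 0; first by rewrite !scaler0 !subr0.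
have ww : dotv w w != 0 by rewrite dotvv_eq0.
rewrite dotvBl dotvZl mulfVK// -addrA -opprD -scalerDl.
rewrite [X in X *: _](_ : _ = 0) ?scale0r ?subr0//.
by field.
Qed.

Lemma reflect_swapE u v : dotv u u = dotv v v -> reflect_swap u v u = v.
Proof.
move=> uv; rewrite /reflect_swap.
have [w0|w0] := eqVneq (u - v) 0.
  by rewrite w0 scaler0 subr0; apply/eqP; rewrite -subr_eq0 w0.
have ww : dotv (u - v) (u - v) != 0 by rewrite dotvv_eq0.
rewrite [X in X *: _](_ : _ = 1) ?scale1r ?subKr//.
apply: (mulIf ww); rewrite mulfVK// mul1r !dotvE (dotvC v u) uv; ring.
Qed.

Lemma measurable_dotv d (T : measurableType d) (f : T -> 'rV[R]_n) (w : 'rV[R]_n) :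
  measurable_fun setT f -> measurable_fun setT (fun t => dotv (f t) w).
Proof.
move=> /measurable_fun_rVP mf; apply: measurable_sum => i.
by apply: (measurable_funM (f := coord_rV i \o f)).
Qed.

Lemma measurable_reflect_swap u v : measurable_fun setT (reflect_swap u v).
Proof.
apply: measurable_subrV => //; apply/measurable_fun_rVP => i.
rewrite (_ : _ \o _ = fun x => (2 / dotv (u - v) (u - v) * (u - v) ord0 i) *
    dotv x (u - v)); last first.
  by apply/funext => x; rewrite /coord_rV /= mxE; ring.
by apply: measurable_funM => //; exact: measurable_dotv.
Qed.

End euclidean_structure.

Section linear_change_of_variables.
Local Open Scope ereal_scope.
Context {R : realType} (n : nat).
Variables f g : 'rV[R]_n -> 'rV[R]_n.
Hypotheses (mf : measurable_fun setT f) (mg : measurable_fun setT g).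
Hypotheses (fD : {morph f : x y / (x + y)%R >-> (x + y)%R}).
Hypotheses (fK : cancel f g) (gK : cancel g f).
Local Notation lam := (@lebesgue_rV R n).

(** The image of Lebesgue measure under an additive bijection is translation
    invariant. *)
Lemma lebesgue_rV_linear_swap (A B : set 'rV[R]_n) :
  measurable A -> measurable B ->
  lam A * lam (f @^-1` B) = lam (f @^-1` (-%R @^-1` A)) * lam B.
Proof.
have sf : sigma_finite setT (image_measure lam mf).
  have /sigma_finiteP[F [TF ndF Foo]] := sigma_finiteT lam.
  exists (fun k => g @^-1` F k).
    by rewrite -preimage_bigcup -TF preimage_setT.
  move=> k; have [mF Fk] := Foo k; split; first exact: measurable_rV_preimage.
  rewrite /= /pushforward -comp_preimage.
  by rewrite (_ : g \o f = id) ?preimage_id//; apply/funext => x /=.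
pose m := Measure_isSigmaFinite.Build _ _ _ (image_measure lam mf) sf.
pose nu : {sigma_finite_measure set 'rV[R]_n -> \bar R} :=
  HB.pack (image_measure lam mf) m.
move=> mA mB; rewrite -[LHS]/(lam A * nu B) -[RHS]/(nu (-%R @^-1` A) * lam B).
apply: translation_invariant_swap => // v C mC.
rewrite -[LHS]/(lam _) -[RHS]/(lam _) -[RHS](lebesgue_rV_translate (g v)).
  by congr (lebesgue_rV n _); apply/seteqP; split => x /=; rewrite fD gK.
exact: measurable_rV_preimage.
Qed.

End linear_change_of_variables.

(** * Volumes of balls, dilations and isometries *)

Section balls.
Local Open Scope ereal_scope.
Context {R : realType}.

Definition eball n (r : R) : set 'rV[R]_n := [set x | (enorm x <= r)%R].

Definition cube n (r : R) : set 'rV[R]_n :=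
  [set x | forall i, (`[(- r)%R, r]%classic : set (measurableTypeR R)) (x ord0 i)].

Arguments eball n r : clear implicits.
Arguments cube n r : clear implicits.

Lemma unit_ballE n : unit_ball = eball n 1%R.
Proof. by []. Qed.

Lemma measurable_eball n r : measurable (eball n r).
Proof. by apply: measurable_ler => //; exact: measurable_enorm. Qed.

Lemma measurable_cube n r : measurable (cube n r).
Proof.
rewrite [X in measurable X](_ : _ = \bigcap_(i in [set: 'I_n])
   (coord_rV i @^-1` `[(- r)%R, r]%classic)).
  apply: fin_bigcap_measurable => // i _; rewrite -[X in measurable X]setTI.
  by apply: measurable_coord_rV => //; exact: measurable_itv.
by apply/seteqP; split => x /= Ax i; [move=> _|]; exact: Ax.
Qed.

Lemma lebesgue_rV_cube n r : (0 <= r)%R ->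
  lebesgue_rV n (cube n r) = ((2 * r) ^+ n)%:E.
Proof.
move=> r0; rewrite (lebesgue_rV_box (A := fun=> `[(- r)%R, r]%classic)).
  2: by move=> i; exact: measurable_itv.
under eq_bigr do rewrite lebesgue_measure_itv /= lte_fin.
rewrite (eq_bigr (fun=> (2 * r)%:E)) => [|i _].
  by rewrite prodEFin big_const_ord iter_mulr_1.
case: ifPn => [_|]; first by rewrite -EFinB opprK mulr_natl mulr2n.
by rewrite -leNgt => H; congr EFin; lra.
Qed.

Lemma eball_sub_cube n r : eball n r `<=` cube n r.
Proof.
move=> x /= xr i; rewrite /= in_itv /= -ler_norml (le_trans _ xr)//.
rewrite -sqrtr_sqr enormE ler_wsqrtr// /dotv (bigD1 i)//= -expr2 lerDl.
by apply: sumr_ge0 => j _; rewrite -expr2 sqr_ge0.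
Qed.

(** This cube makes the volume of the ball positive; the side [2 / (n + 1)]
    makes sense in dimension 0 too. *)
Lemma cube_sub_unit_ball n : cube n (n.+1%:R^-1)%R `<=` unit_ball.
Proof.
move=> x xr; rewrite unit_ballE /eball /= enorm_leE ?ler01// expr1n.
apply: (@le_trans _ _ (\sum_(i < n) n.+1%:R^-1)%R).
  apply: ler_sum => i _; have := xr i; rewrite /= in_itv /= -ler_norml => xi.
  rewrite -expr2 -[(x _ _ ^+ 2)%R]real_normK ?num_real// expr2.
  by rewrite -[leRHS]mulr1 ler_pM// (le_trans xi)// invf_le1 ?ler1n// ltr0n.
rewrite sumr_const card_ord -[(_ *+ n)%R]mulr_natl.
by rewrite ler_pdivrMr ?ltr0n// mul1r ler_nat.
Qed.

Definition ball_volume n : R := fine (lebesgue_rV n unit_ball).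

Lemma ball_volumeE n : lebesgue_rV n unit_ball = (ball_volume n)%:E.
Proof.
rewrite /ball_volume fineK// ge0_fin_numE ?measure_ge0//.
apply: le_lt_trans (ltry ((2 * 1) ^+ n)%R).
rewrite -lebesgue_rV_cube ?ler01//; apply: le_measure; rewrite ?inE.
- exact: measurable_eball.
- exact: measurable_cube.
- exact: eball_sub_cube.
Qed.

Lemma ball_volume_gt0 n : (0 < ball_volume n)%R.
Proof.
rewrite -lte_fin -ball_volumeE.
apply: (@lt_le_trans _ _ ((2 * n.+1%:R^-1) ^+ n)%:E).
  by rewrite lte_fin exprn_gt0// mulr_gt0// invr_gt0 ltr0n.
rewrite -lebesgue_rV_cube ?invr_ge0//; apply: le_measure; rewrite ?inE.
- exact: measurable_cube.
- exact: measurable_eball.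
- exact: cube_sub_unit_ball.
Qed.

Lemma ball_volume_ge0 n : (0 <= ball_volume n)%R.
Proof. exact/ltW/ball_volume_gt0. Qed.

(** The factor is found on a cube, where the volume is explicit. *)
Lemma lebesgue_rV_scale n r (A : set 'rV[R]_n) : (0 < r)%R -> measurable A ->
  lebesgue_rV n ((fun x => r *: x)%R @^-1` A) = (r ^- n)%:E * lebesgue_rV n A.
Proof.
move=> r0 mA; have rN0 : r != 0%R by rewrite gt_eqF.
have mf : measurable_fun setT (fun x : 'rV[R]_n => r *: x)%R.
  exact: measurable_scalerV.
have mg : measurable_fun setT (fun x : 'rV[R]_n => r^-1 *: x)%R.
  exact: measurable_scalerV.
have := lebesgue_rV_linear_swap mf mg (scalerDr r) (scalerK rN0)
  (scalerKV rN0) (@measurable_cube n 1%R) mA.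
rewrite [X in _ = lebesgue_rV n X * _](_ : _ = cube n (r^-1)%R).
  rewrite !lebesgue_rV_cube ?invr_ge0 ?ler01 ?(ltW r0)// mulr1 exprMn EFinM.
  rewrite -muleA => /(congr1 (fun z : \bar R => (2 ^- n)%:E * z)).
  by rewrite !muleA -!EFinM mulVf ?expf_neq0 ?pnatr_eq0// mul1e mul1r exprVn.
apply/seteqP; split => x /= xr i; have := xr i; rewrite /= !in_itv /= !mxE;
  rewrite -!ler_norml normrN normrM gtr0_norm//.
- by rewrite -ler_pdivlMl// mulr1.
- by move=> ?; rewrite -ler_pdivlMl// mulr1.
Qed.

(** The unit ball, preserved by [f] and of finite positive volume, shows that
    the factor is 1. *)
Lemma lebesgue_rV_isometry n (f g : 'rV[R]_n -> 'rV[R]_n) (A : set 'rV[R]_n) :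
  measurable_fun setT f -> measurable_fun setT g ->
  {morph f : x y / (x + y)%R >-> (x + y)%R} -> cancel f g -> cancel g f ->
  (forall x, enorm (f x) = enorm x) -> measurable A ->
  lebesgue_rV n (f @^-1` A) = lebesgue_rV n A.
Proof.
move=> mf mg fD fK gK f_iso mA.
have := lebesgue_rV_linear_swap mf mg fD fK gK (@measurable_eball n 1%R) mA.
rewrite (_ : f @^-1` (-%R @^-1` eball n 1) = eball n 1%R); last first.
  by apply/seteqP; split => x; rewrite /eball /= enormN f_iso.
rewrite -unit_ballE ball_volumeE.
move=> /(congr1 (fun z : \bar R => (ball_volume n)^-1%:E * z)).
by rewrite !muleA -EFinM mulVf ?gt_eqF ?ball_volume_gt0// !mul1e.
Qed.

Lemma lebesgue_rV_opp n (A : set 'rV[R]_n) : measurable A ->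
  lebesgue_rV n (-%R @^-1` A) = lebesgue_rV n A.
Proof.
apply: (@lebesgue_rV_isometry _ _ -%R); [exact: measurable_opprV..| | | |].
- exact: opprD.
- exact: opprK.
- exact: opprK.
- exact: enormN.
Qed.

Lemma lebesgue_rV_subl n (u : 'rV[R]_n) (A : set 'rV[R]_n) : measurable A ->
  lebesgue_rV n ((fun v => u - v)%R @^-1` A) = lebesgue_rV n A.
Proof.
move=> mA; rewrite -[RHS](lebesgue_rV_translate u)// -[RHS]lebesgue_rV_opp.
  by congr (lebesgue_rV n _); apply/seteqP; split => v /=; rewrite addrC.
by apply: measurable_rV_preimage => //; exact: measurable_addrV.
Qed.

Lemma lebesgue_rV_reflect_swap n u v (A : set 'rV[R]_n) : measurable A ->
  lebesgue_rV n (reflect_swap u v @^-1` A) = lebesgue_rV n A.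
Proof.
apply: (@lebesgue_rV_isometry _ _ (reflect_swap u v));
  [exact: measurable_reflect_swap..| | | |].
- exact: reflect_swapD.
- exact: reflect_swapK.
- exact: reflect_swapK.
- by move=> x; rewrite !enormE dotv_reflect_swap.
Qed.

Lemma lebesgue_rV_eball n r : (0 <= r)%R ->
  lebesgue_rV n (eball n r) = (r ^+ n * ball_volume n)%:E.
Proof.
rewrite le_eqVlt => /orP[/eqP<-|r0].
  case: n => [|n].
    by rewrite expr0 mul1r -ball_volumeE; congr (lebesgue_rV 0 _);
      apply/seteqP; split => x _; rewrite /eball /unit_ball /= (thinmx0 x) enorm0.
  rewrite expr0n /= mul0r; apply/eqP; rewrite eq_le measure_ge0 andbT.
  have <- : lebesgue_rV n.+1 (cube n.+1 0%R) = 0%:E.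
    by rewrite lebesgue_rV_cube// mulr0 expr0n.
  apply: le_measure; rewrite ?inE.
  - exact: measurable_eball.
  - exact: measurable_cube.
  - exact: eball_sub_cube.
rewrite (_ : eball n r = (fun x => r^-1 *: x)%R @^-1` unit_ball).
  rewrite lebesgue_rV_scale ?invr_gt0//; last exact: measurable_eball.
  by rewrite exprVn invrK ball_volumeE.
apply/seteqP; split => x; rewrite /unit_ball /eball /= enormZ;
  rewrite ger0_norm ?invr_ge0 ?(ltW r0)//;
  by rewrite ler_pdivrMl// mulr1.
Qed.

End balls.

Arguments eball {R} n r.
Arguments cube {R} n r.

(** * Slices and caps of the unit ball *)

Section slices.
Local Open Scope ereal_scope.
Context {R : realType}.
Local Notation mu := (@lebesgue_measure R).

Lemma lebesgue_rVS_integral n (f : 'rV[R]_n.+1 -> \bar R) :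
  measurable_fun setT f -> (forall x, 0 <= f x) ->
  \int[lebesgue_rV n.+1]_x f x =
  \int[mu]_t \int[lebesgue_rV n]_w f (cons_rV (t, w)).
Proof.
move=> mf f0; have mcons := @measurable_cons_rV R n.
rewrite (ge0_integral_pushforward mcons)//.
rewrite (fubini_tonelli1 (f \o @cons_rV R n))//=.
exact: measurableT_comp mf mcons.
Qed.

Lemma lebesgue_rVS_set n (A : set 'rV[R]_n.+1) :
  lebesgue_rV n.+1 A = \int[mu]_t lebesgue_rV n [set w | A (cons_rV (t, w))].
Proof. exact: product_measure_set1. Qed.

Lemma dotv_cons n (t s : R) (v w : 'rV[R]_n) :
  dotv (cons_rV (t, v)) (cons_rV (s, w)) = (t * s + dotv v w)%R.
Proof.
rewrite /dotv big_ord_recl !cons_rV0; congr (_ + _)%R.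
by apply: eq_bigr => i _; rewrite !cons_rVS.
Qed.

Lemma enorm_cons_le1 n (t : R) (w : 'rV[R]_n) : (-1 <= t <= 1)%R ->
  (enorm (cons_rV (t, w)) <= 1)%R = (enorm w <= Num.sqrt (1 - t ^+ 2))%R.
Proof.
move=> t1; have t2 : (t ^+ 2 <= 1)%R.
  by rewrite -[(t ^+ 2)%R]real_normK ?num_real// expr_le1// ler_norml.
rewrite !enorm_leE ?sqrtr_ge0 ?ler01// sqr_sqrtr ?subr_ge0//.
by rewrite dotv_cons expr1n lerBrDl expr2.
Qed.

(** Volume of the slice at height [t] of the unit ball of dimension [n + 1]. *)
Definition slice_volume n (t : R) : R :=
  (ball_volume n * Num.sqrt (1 - t ^+ 2) ^+ n)%R.

Lemma slice_volume_ge0 n t : (0 <= slice_volume n t)%R.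
Proof.
by rewrite mulr_ge0 ?exprn_ge0 ?sqrtr_ge0// ball_volume_ge0.
Qed.

Lemma measurable_slice_volume n : measurable_fun setT (slice_volume n).
Proof.
apply: measurable_funM => //; apply: measurable_funX.
apply: (measurableT_comp (f := @Num.sqrt R)).
  by apply: continuous_measurable_fun; exact: sqrt_continuous.
by apply: measurable_funB => //; exact: measurable_funX.
Qed.

(** The slices of a ball are balls of one dimension less. *)
Lemma unit_ball_slices n (T : set (measurableTypeR R)) : measurable T ->
  T `<=` `[(-1)%R, 1%R] ->
  lebesgue_rV n.+1 [set v | (enorm v <= 1)%R /\ T (v ord0 ord0)] =
  \int[mu]_(t in T) (slice_volume n t)%:E.
Proof.
move=> mT T1; rewrite lebesgue_rVS_set [RHS]integral_mkcond.
apply: eq_integral => t _; rewrite patchE.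
case: ifPn => [/set_mem tT|/negP tT].
  rewrite /slice_volume mulrC -lebesgue_rV_eball ?sqrtr_ge0//; congr (lebesgue_rV n _).
  have t1 : (-1 <= t <= 1)%R by have := T1 _ tT; rewrite /= in_itv.
  by apply/seteqP; split => w; rewrite /eball /= cons_rV0 enorm_cons_le1// => -[].
rewrite (_ : [set w | _] = set0) ?measure0//.
by apply/seteqP; split => w //= [_]; rewrite cons_rV0 => /mem_set.
Qed.

Definition axis0 n : 'rV[R]_n.+1 := cons_rV (1%R, 0%R).

Lemma dotv_axis0 n (v : 'rV[R]_n.+1) : dotv v (axis0 n) = v ord0 ord0.
Proof.
rewrite /dotv big_ord_recl cons_rV0 mulr1 big1 ?addr0// => i _.
by rewrite cons_rVS mxE mulr0.
Qed.

Lemma measurable_ball_dotv n (u : 'rV[R]_n) (T : set (measurableTypeR R)) :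
  measurable T ->
  measurable [set v : 'rV[R]_n | (enorm v <= 1)%R /\ T (dotv v u)].
Proof.
move=> mT; apply: measurableI; first exact: measurable_eball.
rewrite -[X in measurable X]setTI.
by apply: (@measurable_dotv _ _ _ _ id).
Qed.

(** The reflection that exchanges [u] and the first axis preserves the ball and
    the volume. *)
Lemma unit_ball_slices_dir n (u : 'rV[R]_n.+1) (T : set (measurableTypeR R)) :
  measurable T -> enorm u = 1%R ->
  lebesgue_rV n.+1 [set v | (enorm v <= 1)%R /\ T (dotv v u)] =
  lebesgue_rV n.+1 [set v | (enorm v <= 1)%R /\ T (v ord0 ord0)].
Proof.
move=> mT u1.
rewrite -(lebesgue_rV_reflect_swap u (axis0 n)); last exact: measurable_ball_dotv.
have ue : dotv u u = dotv (axis0 n) (axis0 n).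
  by rewrite -sqr_enorm u1 dotv_axis0 cons_rV0 expr1n.
congr (lebesgue_rV _ _); apply/seteqP; split => v /=;
  rewrite !enormE dotv_reflect_swap -(dotv_axis0 v);
  rewrite -(dotv_reflect_swap u (axis0 n) _ u);
  by rewrite reflect_swapK (reflect_swapE ue).
Qed.

(** With either inequality, because the bounding hyperplane is negligible. *)
Lemma unit_ball_cap n (u : 'rV[R]_n.+1) (a : R) b : enorm u = 1%R ->
  (-1 <= a)%R ->
  lebesgue_rV n.+1 [set v | (enorm v <= 1)%R /\ (a < dotv v u ?<= if b)%R] =
  \int[mu]_(t in `[a, 1%R]) (slice_volume n t)%:E.
Proof.
move=> u1 a1; pose T : set R := [set` Interval (BSide b a) (BRight 1%R)].
have mT : measurable (T : set (measurableTypeR R)) by exact: measurable_itv.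
transitivity (lebesgue_rV n.+1 [set v | (enorm v <= 1)%R /\ T (dotv v u)]).
  congr (lebesgue_rV _ _); apply/seteqP; split => v /= [v1].
    move=> av; split => //; rewrite /T /= in_itv /= av /=.
    by rewrite (le_trans (dotv_le_enorm _ _))// u1 mulr1.
  by rewrite /T /= in_itv /= => /andP[].
rewrite unit_ball_slices_dir// unit_ball_slices//.
  rewrite /T; case: b {T mT} => //; rewrite integral_itv_obnd_cbnd//.
  by apply/measurable_EFinP/measurable_funTS; exact: measurable_slice_volume.
move=> t; rewrite /T /= !in_itv /= => /andP[/lteifW at_ ->].
by rewrite (le_trans a1 at_).
Qed.

End slices.

(** * Lenses *)

Section lens.
Local Open Scope ereal_scope.
Context {R : realType} (n : nat).
Local Notation mu := (@lebesgue_measure R).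
Local Notation lam := (@lebesgue_rV R n.+1).

Lemma dotv_sub_unit (e v : 'rV[R]_n.+1) (a : R) : dotv e e = 1%R ->
  dotv (v - a *: e) (v - a *: e) = (dotv v v - 2 * a * dotv v e + a ^+ 2)%R.
Proof. by move=> ee; rewrite !dotvE (dotvC e v) ee; ring. Qed.

(** The hyperplane bisecting the lens cuts it into two caps, exchanged by the
    symmetry [v |-> u - v]. *)
Lemma lens_volume (u : 'rV[R]_n.+1) : u != 0%R ->
  lam [set v | (enorm v <= 1)%R /\ (enorm (v - u)%R <= 1)%R] =
  2%:E * \int[mu]_(t in `[(enorm u / 2)%R, 1%R]) (slice_volume n t)%:E.
Proof.
move=> u0; pose a := enorm u.
have a0 : (0 < a)%R.
  by rewrite lt0r enorm_ge0 andbT -sqrf_eq0 sqr_enorm dotvv_eq0.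
have aN0 : a != 0%R by rewrite gt_eqF.
pose e := (a^-1 *: u)%R.
have e1 : enorm e = 1%R by rewrite enormZ ger0_norm ?invr_ge0 ?ltW// mulVf.
have ue : u = (a *: e)%R by rewrite scalerA divff// scale1r.
have ee : dotv e e = 1%R by rewrite -sqr_enorm e1 expr1n.
have Ea : (-1 <= a / 2)%R by rewrite (@le_trans _ _ 0%R) ?divr_ge0 ?ltW ?oppr_le0.
pose cap b := [set v : 'rV[R]_n.+1 |
  (enorm v <= 1)%R /\ (a / 2 < dotv v e ?<= if b)%R].
have capE b : lam (cap b) = \int[mu]_(t in `[(a / 2)%R, 1%R]) (slice_volume n t)%:E.
  exact: unit_ball_cap.
have mcap b : measurable (cap b).
  rewrite [X in measurable X](_ : _ = [set v : 'rV[R]_n.+1 | (enorm v <= 1)%R /\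
      [set` Interval (BSide b (a / 2)%R) +oo%O] (dotv v e)]).
    by apply: measurable_ball_dotv; exact: measurable_itv.
  by apply/seteqP; split => v /=; rewrite in_itv /= andbT.
have mV : measurable_fun setT (fun v : 'rV[R]_n.+1 => (u - v)%R).
  by apply: measurable_subrV.
rewrite (_ : [set v | _] = cap true `|` (fun v => (u - v)%R) @^-1` cap false).
  rewrite measureU//.
  - transitivity (lam (cap true) + lam ((fun v => (u - v)%R) @^-1` cap false)) => //.
    by rewrite lebesgue_rV_subl// !capE -mule2n [RHS]mule_natl.
  - exact: measurable_rV_preimage.
  - apply/seteqP; split => // v [[_ /= v1] [_ /=]].
    by rewrite dotvBl {1}ue dotvZl ee; lra.
apply/seteqP; split => v.
  move=> [v1 vu1]; rewrite /cap /=.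
  have [av|av] := leP (a / 2)%R (dotv v e); [left|right].
    by split.
  rewrite -enormB; split => //.
  by rewrite dotvBl {1}ue dotvZl ee; lra.
have vuE : dotv (v - u) (v - u) = (dotv v v - 2 * a * dotv v e + a ^+ 2)%R.
  by rewrite [in LHS]ue dotv_sub_unit.
have a2 : (a ^+ 2 = a * (a / 2) * 2)%R by field.
case=> -[/= v1 v2].
  split => //; move: v1; rewrite !enorm_leE ?ler01// => v1.
  rewrite vuE; apply: le_trans v1; rewrite a2 -addrA gerDl.
  have : (a * (a / 2) <= a * dotv v e)%R by rewrite ler_pM2l.
  lra.
rewrite -enormB; split => //; move: v1; rewrite -enormB !enorm_leE ?ler01//.
rewrite vuE => v1; apply: le_trans v1; rewrite a2 -addrA lerDl.
move: v2; rewrite dotvBl {1}ue dotvZl ee => v2.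
have : (a * dotv v e <= a * (a / 2))%R by rewrite ler_pM2l//; lra.
lra.
Qed.

End lens.

(** * Pairs of points of the ball at a given distance *)

Section shells.
Local Open Scope ereal_scope.
Context {R : realType}.

(** An open ball is the increasing union of the closed balls of radius
    [r (1 - 1/k)]: spheres are negligible. *)
Lemma lebesgue_rV_open_ball n (r : R) : (0 < r)%R ->
  lebesgue_rV n [set x | (enorm x < r)%R] = (r ^+ n * ball_volume n)%:E.
Proof.
move=> r0; pose F k := eball n (r * (1 - harmonic k))%R.
have h0 k : (0 < @harmonic R k)%R by rewrite /harmonic /= invr_gt0.
have h1 k : (harmonic k <= 1 :> R)%R by rewrite /harmonic /= invf_le1// ler1n.
have UF : \bigcup_k F k = [set x | (enorm x < r)%R].
  apply/seteqP; split => [x [k _] /= xk|x /= xr].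
    by rewrite (le_lt_trans xk)// gtr_pMr// gtrBl.
  have : (0 < 1 - enorm x / r)%R by rewrite subr_gt0 ltr_pdivrMr// mul1r.
  move=> d0; have [k] : exists k, (harmonic k < 1 - enorm x / r)%R.
    have := cvgr_lt (0 : R) (@cvg_harmonic R) _ d0.
    by move=> [k _ kH]; exists k; apply: kH => /=.
  move=> kx; exists k => //; rewrite /F /eball /=.
  by rewrite -ler_pdivrMl// mulrC lerBrDr addrC -lerBrDr ltW.
have cF : lebesgue_rV n \o F @ \oo --> lebesgue_rV n (\bigcup_k F k).
  apply: nondecreasing_cvg_mu.
  - by move=> k; exact: measurable_eball.
  - by apply: bigcupT_measurable => k; exact: measurable_eball.
  - move=> i j ij; apply/subsetPset => x; rewrite /F /eball /= => /le_trans; apply.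
    by rewrite ler_pM2l// lerD2l lerN2 lef_pV2 ?posrE ?ltr0n// ler_nat.
rewrite -UF; apply: (cvg_unique _ cF) => //.
rewrite (_ : _ \o F = EFin \o (fun k => (r * (1 - harmonic k)) ^+ n * ball_volume n)%R).
  apply: cvg_EFin; first by near=> k.
  rewrite (_ : _ \o _ = (fun k => (r * (1 - harmonic k)) ^+ n * ball_volume n)%R)//.
  rewrite -[X in (X ^+ n)%R]mulr1 -[X in (r * X)%R]subr0.
  apply: cvgMl; apply: (cvg_comp _ (fun x => x ^+ n)%R); last first.
    exact: exprn_continuous.
  by apply: cvgMr; apply: cvgB; [exact: cvg_cst|exact: cvg_harmonic].
apply/funext => k /=; rewrite lebesgue_rV_eball// mulr_ge0 ?subr_ge0// ltW//.
Unshelve. all: by end_near.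
Qed.

Lemma lebesgue_rV_shell n (r s : R) : (0 < r)%R -> (r <= s)%R ->
  lebesgue_rV n [set x | (r <= enorm x)%R /\ (enorm x <= s)%R] =
  ((s ^+ n - r ^+ n) * ball_volume n)%:E.
Proof.
move=> r0 rs; have s0 : (0 < s)%R by exact: lt_le_trans rs.
pose O := [set x : 'rV[R]_n | (enorm x < r)%R].
have mO : measurable O.
  rewrite (_ : O = ~` [set x : 'rV[R]_n | (r <= enorm x)%R]).
    by apply: measurableC; apply: measurable_ler => //; exact: measurable_enorm.
  by apply/seteqP; split => x; rewrite /O /= ltNge => /negP.
rewrite (_ : [set x | _] = eball n s `\` O).
  rewrite measureD//=; last 2 first.
  - exact: measurable_eball.
  - by rewrite [ltLHS]lebesgue_rV_eball ?ltW// ltry.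
  rewrite (_ : eball n s `&` O = O).
    rewrite [X in X - _]lebesgue_rV_eball ?ltW// [X in _ - X]lebesgue_rV_open_ball//.
    by rewrite -EFinB mulrBl.
  apply/seteqP; split => x; first by case.
  by rewrite /O /eball /= => xr; split => //; rewrite (le_trans (ltW xr)).
apply/seteqP; split => x; rewrite /eball /O /=.
  by move=> [rx xs]; split => //; apply/negP; rewrite -leNgt.
by move=> [xs /negP]; rewrite -leNgt.
Qed.

End shells.

Section pairs.
Local Open Scope ereal_scope.
Context {R : realType} (n : nat).
Local Notation mu := (@lebesgue_measure R).
Local Notation lam := (@lebesgue_rV R n.+1).

Definition far_pairs (r : R) : set ('rV[R]_n.+1 * 'rV[R]_n.+1) :=
  [set xy | (r <= enorm (xy.1 - xy.2)%R)%R].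

Definition ball_pairs : set ('rV[R]_n.+1 * 'rV[R]_n.+1) :=
  unit_ball `*` unit_ball.

Lemma measurable_far_pairs r : measurable (far_pairs r).
Proof.
apply: measurable_ler => //; apply: measurable_enorm.
by apply: measurable_subrV.
Qed.

Lemma measurable_ball_pairs : measurable ball_pairs.
Proof. by apply: measurableX; exact: measurable_eball. Qed.

(** Substitution of [u = x - y] for [y]. *)
Lemma far_pairs_volume_lens (r : R) : (0 < r)%R ->
  (lam \x lam) (far_pairs r `&` ball_pairs) =
  \int[lam]_(u in [set u | (r <= enorm u)%R])
     lam [set v | (enorm v <= 1)%R /\ (enorm (v - u)%R <= 1)%R].
Proof.
move=> r0; rewrite product_measure_set1.
pose F := [set xu : 'rV[R]_n.+1 * 'rV[R]_n.+1 | (r <= enorm xu.2)%R] `&`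
  [set xu : 'rV[R]_n.+1 * 'rV[R]_n.+1 |
    (enorm xu.1 <= 1)%R /\ (enorm (xu.1 - xu.2)%R <= 1)%R].
have mF : measurable F.
  apply: measurableI; last apply: measurableI.
  - by apply: measurable_ler => //; exact: measurable_enorm.
  - by apply: measurable_ler => //; exact: measurable_enorm.
  - apply: measurable_ler => //; apply: measurable_enorm.
    by apply: measurable_subrV.
transitivity ((lam \x lam) F).
  rewrite product_measure_set1; apply: eq_integral => x _.
  rewrite -[LHS](lebesgue_rV_subl x).
    congr (lam _); apply/seteqP; split => u; rewrite /far_pairs /ball_pairs /F;
      by rewrite /unit_ball /= subKr.
  have mx : measurable_fun setT (fun y : 'rV[R]_n.+1 => (x, y)).
    by apply: measurable_fun_pair.
  rewrite [X in measurable X](_ : _ = (fun y => (x, y)) @^-1`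
     (far_pairs r `&` ball_pairs))//.
  rewrite -[X in measurable X]setTI; apply: mx => //.
  by apply: measurableI; [exact: measurable_far_pairs|exact: measurable_ball_pairs].
rewrite (product_measure_set2 _ _ mF) [RHS]integral_mkcond.
apply: eq_integral => u _.
rewrite patchE; case: ifPn => [/set_mem ru|/negP ru].
  by congr (lam _); apply/seteqP; split => v; rewrite /F /=; [case|].
rewrite (_ : [set v | _] = set0) ?measure0//.
by apply/seteqP; split => v //= [/= /mem_set].
Qed.

(** The lens over [u] is twice an integral of slices at the heights [t]
    from [enorm u / 2] to 1. Exchanging the integrals leaves, at each height, the
    volume of the shell of the [u] with [r <= enorm u <= 2 * t]. *)
Lemma far_pairs_volume (r : R) : (0 < r)%R ->
  (lam \x lam) (far_pairs r `&` ball_pairs) =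
  \int[mu]_(t in `[(r / 2)%R, 1%R])
    (2 * slice_volume n t * (((2 * t) ^+ n.+1 - r ^+ n.+1) * ball_volume n.+1))%:E.
Proof.
move=> r0; rewrite far_pairs_volume_lens//.
pose S := [set ut : 'rV[R]_n.+1 * measurableTypeR R |
  (r <= enorm ut.1)%R /\ (enorm ut.1 / 2 <= ut.2)%R /\ (ut.2 <= 1)%R].
have mS : measurable S.
  apply: measurableI; last apply: measurableI.
  - by apply: measurable_ler => //; exact: measurable_enorm.
  - apply: measurable_ler; last exact: measurable_snd.
    apply: measurable_funM; last exact: measurable_cst.
    exact: measurable_enorm.
  - by apply: measurable_ler.
pose G (ut : 'rV[R]_n.+1 * measurableTypeR R) :=
  (2 * slice_volume n ut.2 * \1_S ut)%:E.
have mG : measurable_fun setT G.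
  apply/measurable_EFinP; apply: measurable_funM => //.
  apply: measurable_funM => //.
  by apply: (measurableT_comp (@measurable_slice_volume R n)).
have G0 ut : 0 <= G ut.
  by rewrite lee_fin mulr_ge0 ?indicE ?ler0n// mulr_ge0// slice_volume_ge0.
transitivity (\int[lam]_u \int[mu]_t G (u, t)).
  rewrite integral_mkcond; apply: eq_integral => u _.
  rewrite patchE; case: ifPn => [/set_mem /= ru|/negP ru].
    rewrite lens_volume.
      rewrite -ge0_integralZl_EFin; last 4 first.
      - exact: measurable_itv.
      - by move=> t _; rewrite lee_fin slice_volume_ge0.
      - by apply/measurable_EFinP/measurable_funTS; exact: measurable_slice_volume.
      - exact: ler0n.
      rewrite [LHS]integral_mkcond.
      apply: eq_integral => t _; rewrite patchE /G indicE.
      rewrite (_ : ((u, t) \in S) = (t \in `[(enorm u / 2)%R, 1%R]%classic)).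
        by case: ifPn => _; rewrite ?mulr1 ?mulr0// -EFinM.
      apply/idP/idP => /set_mem h; apply/mem_set; move: h; rewrite /S /= in_itv /=.
        by move=> [_ [-> ->]].
      by move=> /andP[-> ->].
    by apply/eqP => u0; move: ru; rewrite u0 enorm0 leNgt r0.
  rewrite integral0_eq// => t _; rewrite /G indicE.
  by rewrite memNset ?mulr0// => -[/= ru' _]; apply: ru; exact: mem_set.
rewrite (fubini_tonelli G)//.
rewrite [RHS]integral_mkcond; apply: eq_integral => t _.
rewrite patchE; case: ifPn => [/set_mem /=|/negP rt].
  rewrite in_itv /= => /andP[rt t1].
  pose St := [set u : 'rV[R]_n.+1 | (r <= enorm u)%R /\ (enorm u <= 2 * t)%R].
  have mSt : measurable St.
    by apply: measurableI; apply: measurable_ler => //; exact: measurable_enorm.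
  rewrite (eq_integral (fun u => (2 * slice_volume n t)%:E * (\1_St u)%:E)).
    rewrite ge0_integralZl_EFin; last 4 first.
    - exact: measurableT.
    - by move=> u _; rewrite lee_fin indicE ler0n.
    - exact/measurable_EFinP/measurable_indic.
    - by rewrite mulr_ge0// slice_volume_ge0.
    rewrite integral_indic// setIT.
    by rewrite [X in _ * X = _]lebesgue_rV_shell ?EFinM//; lra.
  move=> u _; rewrite /G -EFinM; congr (_ * _)%:E.
  rewrite !indicE; congr (nat_of_bool _)%:R.
  apply/idP/idP => /set_mem h; apply/mem_set; move: h; rewrite /S /St /=.
    by move=> [? [? ?]]; split=> //; lra.
  by move=> [? ?]; split=> //; split; lra.
rewrite integral0_eq// => u _; rewrite /G indicE memNset ?mulr0// /S /=.
by move=> [ru [ut t1]]; apply: rt; apply/mem_set; rewrite /= in_itv /=; lra.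
Qed.

End pairs.

Arguments far_pairs {R n} r.
Arguments ball_pairs {R n}.

(** * The volume of the unit ball *)

Section gaussian.
Local Open Scope ereal_scope.
Context {R : realType}.
Local Notation mu := (@lebesgue_measure R).

Lemma measurable_gauss_rV n :
  measurable_fun setT (fun x : 'rV[R]_n => expR (- enorm x ^+ 2)).
Proof.
apply: measurableT_comp => //; apply: measurableT_comp => //.
by apply: measurable_funX; exact: measurable_enorm.
Qed.

Lemma integral_gauss_rV n :
  \int[lebesgue_rV n]_x (expR (- enorm x ^+ 2))%:E = (Num.sqrt pi ^+ n : R)%:E.
Proof.
elim: n => [|n ih].
  rewrite /= integral_dirac//; last first.
    by apply/measurable_EFinP; exact: measurable_gauss_rV.
  by rewrite diracE mem_set// mul1e enorm0 expr0n /= oppr0 expR0 expr0.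
rewrite lebesgue_rVS_integral; last 2 first.
- by apply/measurable_EFinP; exact: measurable_gauss_rV.
- by move=> x; rewrite lee_fin expR_ge0.
rewrite (eq_integral (fun t : measurableTypeR R =>
    (Num.sqrt pi ^+ n)%:E * (gauss_fun t)%:E)).
  rewrite ge0_integralZl_EFin//.
  - by rewrite integralT_gauss -EFinM -exprSr.
  - by move=> t _; rewrite lee_fin gauss_fun_ge0.
  - by apply/measurable_EFinP; exact: measurable_gauss_fun.
move=> t _; rewrite -ih muleC -ge0_integralZl_EFin//.
- apply: eq_integral => w _; rewrite sqr_enorm dotv_cons -sqr_enorm.
  by rewrite -EFinM opprD expRD.
- by apply/measurable_EFinP; exact: measurable_gauss_rV.
- exact: gauss_fun_ge0.
Qed.

Lemma integral_expRN (a : R) :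
  \int[mu]_(s in `[a, +oo[) (expR (- s))%:E = (expR (- a))%:E.
Proof.
have cN : continuous (fun s : R => expR (- s)).
  by move=> s; apply: continuous_comp; [exact: opp_continuous|exact: continuous_expR].
rewrite (@ge0_continuous_FTC2y _ _ (fun s => - expR (- s))%R _ 0%R).
- by rewrite -EFinB sub0r opprK.
- by move=> x _; exact: expR_ge0.
- exact: continuous_subspaceT.
- by rewrite -oppr0; apply: cvgN; exact: cvgr_expR.
- by move=> x _; exact: ex_derive.
- by apply: cvgN; apply/cvg_at_right_filter; exact: cN.
- by move=> x _; rewrite derive1E derive_val mulrN1 opprK.
Qed.

(** The integral of [expR (- enorm x ^+ 2)] factors over the coordinates; it is
    also a Gamma integral, because the level sets of this function are balls. *)
Lemma ball_volume_Gamma n :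
  (ball_volume n * Gamma (n%:R / 2 + 1) = Num.sqrt pi ^+ n :> R)%R.
Proof.
pose S := [set xs : 'rV[R]_n * measurableTypeR R |
  (enorm xs.1 ^+ 2 <= xs.2)%R].
have mS : measurable S.
  apply: measurable_ler => //; apply: measurable_funX.
  exact: measurable_enorm.
pose G (xs : 'rV[R]_n * measurableTypeR R) := (expR (- xs.2) * \1_S xs)%:E.
have mG : measurable_fun setT G.
  apply/measurable_EFinP; apply: measurable_funM => //.
  by apply: measurableT_comp => //; apply: measurableT_comp.
have G0 xs : 0 <= G xs by rewrite lee_fin mulr_ge0// expR_ge0.
have E1 : \int[lebesgue_rV n]_x \int[mu]_s G (x, s) = (Num.sqrt pi ^+ n : R)%:E.
  rewrite -integral_gauss_rV; apply: eq_integral => x _.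
  rewrite -integral_expRN [RHS]integral_mkcond; apply: eq_integral => s _.
  rewrite patchE /G indicE.
  rewrite (_ : ((x, s) \in S) = (s \in `[(enorm x ^+ 2)%R, +oo[%classic)).
    by case: ifPn => _; rewrite ?mulr1 ?mulr0.
  apply/idP/idP => /set_mem h; apply/mem_set; move: h;
    by rewrite /S /= in_itv /= ?andbT.
have E2 : \int[mu]_s \int[lebesgue_rV n]_x G (x, s) =
    (ball_volume n)%:E * \int[mu]_(s in `]0%R, +oo[)
      (s `^ (n%:R / 2 + 1 - 1) * expR (- s))%:E.
  rewrite -ge0_integralZl_EFin; last 4 first.
  - exact: measurable_itv.
  - by move=> s _; rewrite lee_fin mulr_ge0 ?powR_ge0 ?expR_ge0.
  - apply/measurable_EFinP; apply: measurable_funTS; apply: measurable_funM.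
      exact: measurable_powR.
    by apply: measurableT_comp.
  - exact/ltW/ball_volume_gt0.
  rewrite [LHS](_ : _ = \int[mu]_(s in `[0%R, +oo[) \int[lebesgue_rV n]_x G (x, s)).
    rewrite -integral_itv_obnd_cbnd; last first.
      apply: measurable_funTS.
      exact: (measurable_fun_fubini_tonelli_G (m1 := lebesgue_rV n) G).
    apply: eq_integral => s; rewrite inE /= in_itv /= andbT => s0.
    rewrite (eq_integral (fun x =>
        (expR (- s))%:E * (\1_(eball n (Num.sqrt s)) x)%:E)).
      rewrite ge0_integralZl_EFin; last 4 first.
      - exact: measurableT.
      - by move=> x _; rewrite lee_fin indicE ler0n.
      - by apply/measurable_EFinP/measurable_indic; exact: measurable_eball.
      - exact: expR_ge0.
      rewrite integral_indic//; last exact: measurable_eball.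
      rewrite setIT [X in _ * X]lebesgue_rV_eball ?sqrtr_ge0// -!EFinM addrK.
      rewrite -powR12_sqrt ?ltW// -powR_mulrn ?powR_ge0// -powRrM.
      by rewrite [(2^-1 * n%:R)%R]mulrC; congr EFin; ring.
    move=> x _; rewrite /G -EFinM !indicE; congr (_ * (nat_of_bool _)%:R)%:E.
    apply/idP/idP => /set_mem h; apply/mem_set; move: h; rewrite /S /eball /=;
      by rewrite sqr_enorm enorm_leE ?sqrtr_ge0// sqr_sqrtr ?(ltW s0).
  rewrite [RHS]integral_mkcond; apply: eq_integral => s _; rewrite patchE.
  case: ifPn => // /negP s0; apply: integral0_eq => x _.
  rewrite /G indicE memNset ?mulr0// /S /= => xs.
  by apply: s0; apply/mem_set; rewrite /= in_itv /= andbT (le_trans _ xs)// sqr_ge0.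
have : (ball_volume n)%:E * \int[mu]_(s in `]0%R, +oo[)
      (s `^ (n%:R / 2 + 1 - 1) * expR (- s))%:E = (Num.sqrt pi ^+ n : R)%:E.
  by rewrite -E2 -E1 (fubini_tonelli G).
move=> /(congr1 (fun z : \bar R => (ball_volume n)^-1%:E * z)).
have kN0 : ball_volume n != 0%R :> R by rewrite gt_eqF ?ball_volume_gt0.
rewrite muleA -!EFinM mulVf// mul1e /Gamma /Rintegral => -> /=.
by rewrite mulrA divff// mul1r.
Qed.

End gaussian.

(** * A beta integral *)

Section kernel.
Context {R : realType} (n : nat).
Local Notation mu := (@lebesgue_measure R).

Lemma continuous_sqrt_onem k : continuous (fun t : R => Num.sqrt (1 - t) ^+ k).
Proof.
move=> t; apply: (cvg_comp _ (fun y : R => y ^+ k)); last exact: exprn_continuous.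
apply: (cvg_comp _ Num.sqrt); last exact: sqrt_continuous.
by apply: cvgB; [exact: cvg_cst|exact: cvg_id].
Qed.

Lemma is_derive_sqrt_onem k (t : R) : (t < 1)%R ->
  is_derive t 1%R (fun t : R => Num.sqrt (1 - t) ^+ k.+2)
    (- (k.+2%:R / 2 * Num.sqrt (1 - t) ^+ k))%R.
Proof.
move=> t1; have t0 : (0 < 1 - t)%R by rewrite subr_gt0.
have s0 : Num.sqrt (1 - t) != 0%R by rewrite gt_eqF// sqrtr_gt0.
have D1 : is_derive t 1%R (fun t : R => 1 - t)%R (- 1)%R.
  by rewrite -[X in is_derive _ _ _ X]sub0r; apply: is_deriveB.
have D2 : is_derive t 1 (Num.sqrt \o (fun t : R => 1 - t))
    ((2 * Num.sqrt (1 - t))^-1 * -1).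
  exact: (@is_derive1_comp R Num.sqrt (fun t : R => 1 - t) t _ _
    (is_derive1_sqrt t0) D1).
have := is_deriveX k.+2 D2.
rewrite (_ : _ ^+ k.+2 = (fun t : R => Num.sqrt (1 - t) ^+ k.+2)); last first.
  by apply/funext => x; rewrite fctE.
by move=> D; apply: is_derive_eq; rewrite /GRing.scale /= exprS; field.
Qed.

Lemma integral_sqrt_onem (a : R) : (a < 1)%R ->
  (\int[mu]_(t in `[a, 1%R]) (Num.sqrt (1 - t) ^+ n * (t - a))%:E)%E =
  (4 / (n.+2%:R * n.+4%:R) * Num.sqrt (1 - a) ^+ n.+4)%:E.
Proof.
move=> a1.
(* primitive found by writing [t - a] as [(1 - a) - (1 - t)] *)
pose F (t : R) := (2 / n.+4%:R * Num.sqrt (1 - t) ^+ n.+4 -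
                  (1 - a) * 2 / n.+2%:R * Num.sqrt (1 - t) ^+ n.+2)%R.
have cF : continuous F.
  move=> t; apply: cvgB; apply: cvgMr; exact: continuous_sqrt_onem.
have DF (t : R) : t < 1 -> is_derive t 1 F (Num.sqrt (1 - t) ^+ n * (t - a)).
  move=> t1; have D4 := is_derive_sqrt_onem n.+2 t1.
  have D2 := is_derive_sqrt_onem n t1.
  have D := is_deriveB (is_deriveZ (2 / n.+4%:R) D4)
    (is_deriveZ ((1 - a) * 2 / n.+2%:R) D2).
  apply: (is_derive_eq D); rewrite /GRing.scale /=.
  have -> : Num.sqrt (1 - t) ^+ n.+2 = Num.sqrt (1 - t) ^+ n * (1 - t).
    by rewrite -addn2 exprD sqr_sqrtr// subr_ge0 ltW.
  have : n.+4%:R != 0 :> R by rewrite pnatr_eq0.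
  have : n.+2%:R != 0 :> R by rewrite pnatr_eq0.
  by move: (n.+2%:R : R) (n.+4%:R : R) => p q p0 q0; field; apply/andP.
rewrite (@continuous_FTC2 _ _ F _ _ a1).
- rewrite -EFinB /F subrr sqrtr0 !expr0n /= !mulr0 subrr sub0r; congr EFin.
  have -> : Num.sqrt (1 - a) ^+ n.+4 = Num.sqrt (1 - a) ^+ n.+2 * (1 - a).
    by rewrite -addn2 exprD sqr_sqrtr// subr_ge0 ltW.
  have : n.+4%:R != 0 :> R by rewrite pnatr_eq0.
  have : n.+2%:R != 0 :> R by rewrite pnatr_eq0.
  have : n.+4%:R = n.+2%:R + 2 :> R by rewrite -natrD addn2.
  move: (n.+2%:R : R) (n.+4%:R : R) => p q -> p0 q0.
  by field; apply/andP.
- apply: continuous_subspaceT => t; apply: cvgM; first exact: continuous_sqrt_onem.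
  by apply: cvgB; [exact: cvg_id|exact: cvg_cst].
- split.
  + by move=> t; rewrite in_itv /= => /andP[_ /DF].
  + by apply/cvg_at_right_filter; exact: cF.
  + by apply/cvg_at_left_filter; exact: cF.
- move=> t; rewrite in_itv /= => /andP[_ /DF D].
  by rewrite derive1E derive_val.
Qed.

End kernel.

(** * Bounds for pairs of points almost at distance 2 *)

Section far_bounds.
Context {R : realType} (n : nat).
Local Notation mu := (@lebesgue_measure R).
Local Notation lam := (@lebesgue_rV R n.+1).

Lemma subrX_bounds (a t : R) : 0 <= a -> a <= t -> t <= 1 ->
  n.+1%:R * a ^+ n * (t - a) <= t ^+ n.+1 - a ^+ n.+1 <= n.+1%:R * (t - a).
Proof.
move=> a0 at_ t1; have t0 := le_trans a0 at_; have a1 := le_trans at_ t1.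
rewrite subrXX [_ * (t - a)]mulrC [n.+1%:R * (t - a)]mulrC.
have ta : 0 <= t - a by rewrite subr_ge0.
apply/andP; split; apply: ler_wpM2l => //.
  rewrite mulr_natl -[X in _ *+ X]card_ord -sumr_const.
  apply: ler_sum => i _ /=.
  have -> : a ^+ n = a ^+ (n - i) * a ^+ i by rewrite -exprD subnK// -ltnS.
  by rewrite ler_wpM2r ?exprn_ge0// lerXn2r ?nnegrE.
rewrite -[leRHS]/(1 *+ n.+1) -[X in _ *+ X]card_ord -sumr_const.
by apply: ler_sum => i _; rewrite mulr_ile1 ?exprn_ge0// exprn_ile1.
Qed.

Lemma sqrt_onem_sqr (t : R) : t <= 1 ->
  Num.sqrt (1 - t ^+ 2) = Num.sqrt (1 - t) * Num.sqrt (1 + t).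
Proof. by move=> t1; rewrite -sqrtrM ?subr_ge0//; congr Num.sqrt; ring. Qed.

(** The constants of [far_pairs_volume], times [n + 1] from the derivative of
    [t ^+ n.+1] at 1, times the coefficient of [integral_sqrt_onem]. *)
Definition far_coef : R :=
  2 ^+ n.+2 * ball_volume n * ball_volume n.+1 * n.+1%:R *
  (4 / (n.+2%:R * n.+4%:R)).

(** On [a, 1] the factor [1 + t] of [1 - t ^+ 2] stays between [1 + a] and 2,
    and the slope of [t ^+ n.+1] between [n.+1%:R * a ^+ n] and [n.+1%:R]. What
    remains is the integral of [integral_sqrt_onem], and the two bounds agree
    to the first order as [a] tends to 1. *)
Lemma far_pairs_volume_bounds (a : R) : 0 < a -> a < 1 ->
  ((far_coef * (Num.sqrt (1 + a) ^+ n * a ^+ n) * Num.sqrt (1 - a) ^+ n.+4)%:E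
   <= (lam \x lam) (far_pairs (2 * a) `&` ball_pairs)
   <= (far_coef * Num.sqrt 2 ^+ n * Num.sqrt (1 - a) ^+ n.+4)%:E)%E.
Proof.
move=> a0 a1; rewrite far_pairs_volume ?mulr_gt0//.
rewrite [(2 * a / 2)%R]mulrC mulKf//.
pose K := 2 ^+ n.+2 * ball_volume n * ball_volume n.+1 * n.+1%:R : R.
pose f (t : R) := Num.sqrt (1 - t) ^+ n * (t - a).
have K0 : 0 <= K.
  rewrite /K mulr_ge0// mulr_ge0 ?ball_volume_ge0//.
  by rewrite mulr_ge0 ?ball_volume_ge0// exprn_ge0.
have IK (c : R) : 0 <= c ->
    (\int[mu]_(t in `[a, 1%R]) (K * c * f t)%:E)%E =
    (far_coef * c * Num.sqrt (1 - a) ^+ n.+4)%:E.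
  move=> c0; under eq_integral do rewrite EFinM.
  rewrite ge0_integralZl_EFin; last 4 first.
  - exact: measurable_itv.
  - move=> t; rewrite /= in_itv /= => /andP[at_ t1].
    by rewrite lee_fin /f mulr_ge0 ?subr_ge0// exprn_ge0 ?sqrtr_ge0.
  - apply/measurable_EFinP/measurable_funTS; apply: measurable_funM.
      by apply: continuous_measurable_fun; exact: continuous_sqrt_onem.
    exact: measurable_funB.
  - by rewrite mulr_ge0.
  rewrite integral_sqrt_onem// -EFinM; congr EFin.
  by rewrite /far_coef -/K; ring.
pose g (t : R) := 2 * slice_volume n t * (((2 * t) ^+ n.+1 - (2 * a) ^+ n.+1) *
   ball_volume n.+1).
have gE (t : R) : a <= t -> t <= 1 -> g t = 2 ^+ n.+2 * ball_volume n *
    ball_volume n.+1 * (Num.sqrt (1 - t) ^+ n * Num.sqrt (1 + t) ^+ n *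
      (t ^+ n.+1 - a ^+ n.+1)).
  move=> at_ t1; rewrite /g /slice_volume sqrt_onem_sqr// !exprMn.
  by rewrite [2 ^+ n.+2]exprS; ring.
have fg (c t : R) : 0 <= c -> a <= t -> t <= 1 ->
    K * c * f t = 2 ^+ n.+2 * ball_volume n *
    ball_volume n.+1 * (Num.sqrt (1 - t) ^+ n * (c * (n.+1%:R * (t - a)))).
  by move=> *; rewrite /K /f; ring.
have g_ge0 (t : R) : a <= t -> t <= 1 -> 0 <= g t.
  move=> at_ t1; rewrite /g mulr_ge0//.
    by apply: mulr_ge0 => //; exact: slice_volume_ge0.
  apply: mulr_ge0; last exact: ball_volume_ge0.
  by rewrite subr_ge0 lerXn2r ?nnegrE//; lra.
have mg : measurable_fun `[a, 1] (EFin \o g).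
  apply/measurable_EFinP/measurable_funTS; apply: measurable_funM.
    by apply: measurable_funM => //; exact: measurable_slice_volume.
  apply: measurable_funM => //; apply: measurable_funB => //.
  by apply: measurable_funX; exact: measurable_funM.
have mf (c : R) : measurable_fun `[a, 1] (EFin \o (fun t => K * c * f t)).
  apply/measurable_EFinP/measurable_funTS; apply: measurable_funM => //.
  apply: measurable_funM; last exact: measurable_funB.
  by apply: continuous_measurable_fun; exact: continuous_sqrt_onem.
have f_ge0 (c t : R) : 0 <= c -> a <= t -> t <= 1 -> 0 <= K * c * f t.
  move=> c0 at_ t1; apply: mulr_ge0; first exact: mulr_ge0.
  by apply: mulr_ge0; rewrite ?subr_ge0// exprn_ge0 ?sqrtr_ge0.
have D0 : 0 <= 2 ^+ n.+2 * ball_volume n * ball_volume n.+1 :> R.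
  rewrite mulr_ge0 ?ball_volume_ge0//.
  by rewrite mulr_ge0 ?ball_volume_ge0// exprn_ge0.
apply/andP; split.
  rewrite -IK; last by rewrite mulr_ge0 ?exprn_ge0 ?sqrtr_ge0// ltW.
  apply: ge0_le_integral => //.
  - move=> t; rewrite /= in_itv /= lee_fin => /andP[at_ t1].
    by apply: f_ge0; rewrite // mulr_ge0 ?exprn_ge0 ?sqrtr_ge0// ltW.
  - exact: mf.
  - move=> t; rewrite /= in_itv /= lee_fin => /andP[at_ t1].
    rewrite -/(g t) gE// fg//; last first.
      by rewrite mulr_ge0 ?exprn_ge0 ?sqrtr_ge0// ltW.
    apply: ler_wpM2l => //; rewrite -mulrA; apply: ler_wpM2l.
      by rewrite exprn_ge0 ?sqrtr_ge0.
    rewrite -mulrA; apply: ler_pM.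
    + by rewrite exprn_ge0 ?sqrtr_ge0.
    + by rewrite mulr_ge0 ?exprn_ge0 ?(ltW a0)// mulr_ge0 ?subr_ge0.
    + rewrite lerXn2r ?nnegrE ?sqrtr_ge0// ler_wsqrtr//; lra.
    + have /andP[+ _] := subrX_bounds (ltW a0) at_ t1.
      by apply: le_trans; rewrite mulrCA mulrA.
rewrite -IK ?exprn_ge0 ?sqrtr_ge0//.
apply: ge0_le_integral => //.
- by move=> t; rewrite /= in_itv /= lee_fin => /andP[at_ t1]; exact: g_ge0.
- exact: mf.
- move=> t; rewrite /= in_itv /= lee_fin => /andP[at_ t1].
  rewrite -/(g t) gE// fg ?exprn_ge0 ?sqrtr_ge0//.
  apply: ler_wpM2l => //; rewrite -mulrA; apply: ler_wpM2l.
    by rewrite exprn_ge0 ?sqrtr_ge0.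
  apply: ler_pM.
  + by rewrite exprn_ge0 ?sqrtr_ge0.
  + by rewrite subr_ge0 lerXn2r ?nnegrE; lra.
  + by rewrite lerXn2r ?nnegrE ?sqrtr_ge0// ler_wsqrtr//; lra.
  + by have /andP[_ +] := subrX_bounds (ltW a0) at_ t1.
Qed.

(** No slice of the cap is larger than the ball of squared radius
    [2 * (1 - a)]. *)
Lemma cap_volume_le (a : R) : 0 <= a -> a <= 1 ->
  (\int[mu]_(t in `[a, 1%R]) (slice_volume n t)%:E <=
   (ball_volume n * Num.sqrt 2 ^+ n * Num.sqrt (1 - a) ^+ n.+2)%:E)%E.
Proof.
move=> a0 a1.
have k0 := @ball_volume_ge0 R n.
pose c := ball_volume n * (Num.sqrt 2 * Num.sqrt (1 - a)) ^+ n : R.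
apply: (@le_trans _ _ (\int[mu]_(t in `[a, 1%R]) (cst c%:E) t)%E).
  apply: ge0_le_integral => //.
  - by move=> t _; rewrite lee_fin slice_volume_ge0.
  - by apply/measurable_EFinP/measurable_funTS; exact: measurable_slice_volume.
  - move=> t; rewrite /= in_itv /= lee_fin => /andP[at_ t1].
    apply: ler_wpM2l => //; rewrite lerXn2r ?nnegrE ?mulr_ge0 ?sqrtr_ge0//.
    rewrite -sqrtrM// ler_wsqrtr//.
    by rewrite (_ : 1 - t ^+ 2 = (1 + t) * (1 - t)); [apply: ler_pM; lra|ring].
rewrite integral_cst// [X in (_ * X)%E]lebesgue_measure_itv /= lte_fin.
move: a1; rewrite le_eqVlt => /predU1P[->|a1].
  rewrite ltxx mule0 lee_fin; apply: mulr_ge0; last by rewrite exprn_ge0 ?sqrtr_ge0.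
  by apply: mulr_ge0 => //; rewrite exprn_ge0 ?sqrtr_ge0.
rewrite a1 -EFinB -EFinM lee_fin le_eqVlt; apply/orP; left; apply/eqP.
rewrite -[n.+2]addn2 exprD sqr_sqrtr ?subr_ge0 ?(ltW a1)// /c exprMn; ring.
Qed.

(** A point of the ball almost at distance 2 from [x] lies in the cap opposite
    to [x]. *)
Lemma far_points_volume (x : 'rV[R]_n.+1) (s : R) : enorm x <= 1 ->
  0 < s -> s <= 1 / 2 ->
  (lam [set y | (2 - s <= enorm (x - y))%R /\ (enorm y <= 1)%R] <=
   (ball_volume n * Num.sqrt 2 ^+ n * Num.sqrt (2 * s) ^+ n.+2)%:E)%E.
Proof.
move=> x1 s0 s1.
have sE : 2 * s = 1 - (1 - 2 * s) by ring.
rewrite [X in Num.sqrt X ^+ n.+2]sE.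
apply: le_trans (cap_volume_le _ _); last 2 first.
- lra.
- lra.
have [->|x0] := eqVneq x 0.
  rewrite (_ : [set y | _] = set0) ?measure0 ?integral_ge0//.
    by move=> t _; rewrite lee_fin slice_volume_ge0.
  apply/seteqP; split => y //= [+ y1]; rewrite sub0r enormN; lra.
have a0 : 0 < enorm x.
  by rewrite lt0r enorm_ge0 andbT -sqrf_eq0 sqr_enorm dotvv_eq0.
pose e := - ((enorm x)^-1 *: x).
have e1 : enorm e = 1.
  by rewrite enormN enormZ ger0_norm ?invr_ge0 ?enorm_ge0// mulVf ?gt_eqF.
rewrite -(@unit_ball_cap _ _ e (1 - 2 * s) true e1); last by lra.
apply: le_measure; rewrite ?inE.
- apply: (@measurableI _ _ [set y | 2 - s <= enorm (x - y)]
    [set y | enorm y <= 1]); apply: measurable_ler => //.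
    by apply: measurable_enorm; exact: measurable_subrV.
  exact: measurable_enorm.
- apply: (@measurableI _ _ [set y | enorm y <= 1] [set y | 1 - 2 * s <= dotv y e]).
    exact: measurable_eball.
  by apply: measurable_ler => //; apply: (measurable_dotv (f := id)).
move=> y /= [xy y1]; split=> //.
move: xy; rewrite le_enormE; last by lra.
rewrite !dotvDl !dotvDr !dotvNl !dotvNr opprK (dotvC y x) => xy.
move: (x1) (y1); rewrite !enorm_leE// expr1n => x1' y1'.
have xyE : 1 - 2 * s <= - dotv x y.
  (* [2 dotv x y <= 2 - (2 - s)^2], as [x] and [y] have norm at most 1 *)
  have : (2 - s) ^+ 2 = 4 - 4 * s + s ^+ 2 by ring.
  have := sqr_ge0 s; lra.
rewrite dotvZr (dotvC y x).
apply: (le_trans xyE); rewrite -mulrN ler_peMl ?invf_ge1//; lra.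
Qed.

End far_bounds.

(** * Independence of disjoint families *)

Section independence.
Local Open Scope ereal_scope.
Context d d' (T : measurableType d) (T' : measurableType d') (R : realType).
Variables (P : probability T R).

(** Both sides are measures in [A], up to the constant [P B]; hence the product
    rule passes from a pi-system to the sigma-algebra that it generates. *)
Lemma g_sigma_algebra_indep (G : set (set T)) (B : set T) :
  G `<=` measurable -> setI_closed G -> G setT -> measurable B ->
  (forall A, G A -> P (A `&` B) = P A * P B) ->
  forall A, <<s G >> A -> P (A `&` B) = P A * P B.
Proof.
move=> Gm GI GT mB H A sA.
have PB0 : (0 <= fine (P B))%R by rewrite fine_ge0.
have PBE : (fine (P B))%:E = P B by rewrite fineK ?fin_num_measure.
have := @g_sigma_algebra_measure_unique _ _ _ G Gm (fun=> setT) (fun=> GT) _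
  (mrestr P mB) (mscale (NngNum PB0) P).
move=> /(_ _ GI) h; rewrite -[LHS]/(mrestr P mB A) h//.
- by rewrite -[LHS]/((fine (P B))%:E * P A) PBE muleC.
- by rewrite bigcup_const.
- by move=> C GC; rewrite -[RHS]/((fine (P B))%:E * P C) PBE muleC; exact: H.
- by move=> _; rewrite -[ltLHS]/(P (setT `&` B)) setTI ltey_eq fin_num_measure.
Qed.

Variables (X : nat -> {RV P >-> T'}).

(** A pi-system that generates the events about the [X i] with [i] in [S]. *)
Definition rectangles (S : {fset nat}) : set (set T) :=
  [set D | exists2 A : nat -> set T', (forall i, measurable (A i)) &
    D = \bigcap_(i in [set` S]) X i @^-1` A i].

Definition sigma_of (S : {fset nat}) : set (set T) := <<s rectangles S >>.

Lemma rectangles_measurable S : rectangles S `<=` measurable.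
Proof.
move=> _ [A mA ->]; apply: fin_bigcap_measurable => // i _.
exact: measurable_funPTI.
Qed.

Lemma sigma_of_measurable S : sigma_of S `<=` measurable.
Proof.
exact: (smallest_sub (@sigma_algebra_measurable _ T) (@rectangles_measurable S)).
Qed.

Lemma rectanglesT S : rectangles S setT.
Proof.
exists (fun=> setT); first by move=> _; exact: measurableT.
by apply/esym/seteqP; split.
Qed.

Lemma rectanglesI S : setI_closed (rectangles S).
Proof.
move=> _ _ [A mA ->] [B mB ->]; exists (fun i => A i `&` B i).
  by move=> i; exact: measurableI.
by rewrite -bigcapI.
Qed.

Hypothesis X_indep : mutually_independent X.

Lemma rectangles_indep S S' D E : [disjoint S & S']%fset ->
  rectangles S D -> rectangles S' E -> P (D `&` E) = P D * P E.
Proof.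
move=> SS' [A mA ->] [B mB ->].
rewrite !X_indep; [|by move=> i _; exact: mB|by move=> i _; exact: mA].
pose C i := if i \in S then A i else B i.
have CA i : i \in S -> C i = A i by rewrite /C => ->.
have CB i : i \in S' -> C i = B i.
  rewrite /C; case: ifPn => // iS iS'.
  by move: SS' => /fdisjointP/(_ _ iS); rewrite iS'.
transitivity (P (\bigcap_(i in [set` (S `|` S')%fset]) X i @^-1` C i)).
  congr (P _); apply/seteqP; split => w.
    move=> [wA wB] i /= ; rewrite inE => /orP[iS|iS].
      by rewrite CA//; exact: wA.
    by rewrite CB//; exact: wB.
  move=> wC; split=> i /= iS.
    by rewrite -CA//; apply: wC; rewrite /= inE iS.
  by rewrite -CB//; apply: wC; rewrite /= inE iS orbT.
rewrite X_indep; last by move=> i _; rewrite /C; case: ifP => _.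
have SS'p : perm_eq (S `|` S')%fset (S ++ S').
  apply: uniq_perm; first exact: fset_uniq.
    rewrite cat_uniq !fset_uniq /= andbT; apply/hasPn => i iS'.
    by move: SS'; rewrite fdisjoint_sym => /fdisjointP/(_ _ iS').
  by move=> i; rewrite inE mem_cat.
rewrite (perm_big _ SS'p) big_cat /=; congr (_ * _).
  by apply: eq_big_seq => i iS; rewrite CA.
by apply: eq_big_seq => i iS; rewrite CB.
Qed.

(** The product rule is extended from rectangles to the sigma-algebra in one
    family after the other. *)
Lemma sigma_of_indep S S' D E : [disjoint S & S']%fset ->
  sigma_of S D -> sigma_of S' E -> P (D `&` E) = P D * P E.
Proof.
move=> SS' sD sE; have mE := sigma_of_measurable sE.
apply: (g_sigma_algebra_indep (@rectangles_measurable S) (@rectanglesI S)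
  (rectanglesT S) mE) sD => {}D rD.
have mD := rectangles_measurable rD.
rewrite setIC muleC.
apply: (g_sigma_algebra_indep (@rectangles_measurable S') (@rectanglesI S')
  (rectanglesT S') mD) sE => {mE} {}E rE.
by rewrite setIC muleC; exact: rectangles_indep SS' rD rE.
Qed.

Definition joint i j (w : T) := (X i w, X j w).

Lemma measurable_joint i j : measurable_fun setT (joint i j).
Proof. by apply: measurable_fun_pair; exact: measurable_funP. Qed.

Lemma sigma_of_joint (S : {fset nat}) i j (H : set (T' * T')) :
  i \in S -> j \in S -> measurable H -> sigma_of S (joint i j @^-1` H).
Proof.
have mX k : k \in S ->
    measurable_fun (setT : set (g_sigma_algebraType (rectangles S)))
      (X k : g_sigma_algebraType (rectangles S) -> T').
  move=> kS _ A mA; rewrite setTI; apply: sub_sigma_algebra.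
  exists (fun l => if l == k then A else setT).
    by move=> l; case: ifP.
  apply/seteqP; split => w /=.
    by move=> wA l _; case: eqP => [->|].
  by move=> /(_ k kS); rewrite eqxx.
move=> iS jS mH.
have mJ : measurable_fun (setT : set (g_sigma_algebraType (rectangles S)))
    (joint i j : g_sigma_algebraType (rectangles S) -> T' * T').
  by apply: measurable_fun_pair; exact: mX.
by have := mJ measurableT _ mH; rewrite setTI.
Qed.

Lemma sigma_of_X (S : {fset nat}) i (A : set T') :
  i \in S -> measurable A -> sigma_of S (X i @^-1` A).
Proof.
move=> iS mA; have := @sigma_of_joint S i i (A `*` setT) iS iS.
rewrite (_ : joint i i @^-1` _ = X i @^-1` A).
  by apply; exact: measurableX.
by apply/seteqP; split => w; rewrite /joint /= => // -[].
Qed.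

End independence.

(** * Dissociated events *)

Section no_event.
Context d (T : measurableType d) (R : realType) (P : probability T R).
Implicit Types A B : set T.

Definition Pr A : R := fine (P A).

Lemma PrE A : measurable A -> P A = (Pr A)%:E.
Proof. by move=> mA; rewrite fineK// fin_num_measure. Qed.

Lemma Pr_le A B : measurable A -> measurable B -> A `<=` B -> Pr A <= Pr B.
Proof.
by move=> mA mB AB; rewrite -lee_fin -!PrE// le_measure// inE.
Qed.

Lemma Pr_le1 A : measurable A -> Pr A <= 1.
Proof. by move=> mA; rewrite -lee_fin -PrE// probability_le1. Qed.

Lemma Pr_split A B : measurable A -> measurable B ->
  Pr A = Pr (A `&` B) + Pr (A `&` ~` B).
Proof.
move=> mA mB; have mC := measurableC mB.
have mAB := measurableI _ _ mA mB; have mAC := measurableI _ _ mA mC.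
apply: EFin_inj; rewrite EFinD -!PrE// -measureU//.
  by rewrite -setIUr setUv setIT.
by rewrite setIACA setICr setI0.
Qed.

Variables (I : eqType) (E : I -> set T).

Definition none_of (s : seq I) : set T :=
  [set w | forall a, a \in s -> ~ E a w].

Lemma none_of_nil : none_of [::] = setT.
Proof. by apply/seteqP; split. Qed.

Lemma none_of_cons a s : none_of (a :: s) = none_of s `&` ~` E a.
Proof.
apply/seteqP; split => w.
  move=> H; split; last by apply: H; rewrite mem_head.
  by move=> b bs; apply: H; rewrite inE bs orbT.
by move=> [H1 H2] b; rewrite inE => /predU1P[->|/H1].
Qed.

Lemma none_of_mem s s' : s =i s' -> none_of s = none_of s'.
Proof.
by move=> ss'; apply/seteqP; split => w H a; [rewrite -ss'|rewrite ss'];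
  exact: H.
Qed.

Variable D : pred I.
Hypothesis mE : forall a, D a -> measurable (E a).

Lemma measurable_none_of s : all D s -> measurable (none_of s).
Proof.
elim: s => [|a s ih] /=; first by rewrite none_of_nil.
move=> /andP[Da Ds]; rewrite none_of_cons; apply: measurableI; first exact: ih.
by apply: measurableC; exact: mE.
Qed.

(** Union bound. *)
Lemma none_of_cat_ge A u s (r : R) : measurable A -> all D u -> all D s ->
  (forall b, b \in u -> Pr (A `&` E b) <= r) ->
  Pr (A `&` none_of s) <= Pr (A `&` none_of (u ++ s)) + (size u)%:R * r.
Proof.
move=> mA Du Ds; elim: u Du => [_ _|b u ih /= /andP[Db Du] H].
  by rewrite mul0r addr0.
have mN : measurable (A `&` none_of (u ++ s)).
  by apply: measurableI => //; apply: measurable_none_of; rewrite all_cat Du.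
apply: (le_trans (ih Du _)) => [c cu|]; first by apply: H; rewrite inE cu orbT.
have h : Pr ((A `&` none_of (u ++ s)) `&` E b) <= r.
  apply: le_trans (H b (mem_head _ _)); apply: Pr_le.
  - exact: measurableI mN (mE Db).
  - exact: measurableI mA (mE Db).
  - by move=> w [[? _] ?]; split.
rewrite (Pr_split mN (mE Db)) none_of_cons setIA -natr1 mulrDl mul1r.
by lra.
Qed.

Variables (ov : rel I) (p r : R) (k : nat).
Hypotheses (p_le1 : 0 <= p <= 1) (r_ge0 : 0 <= r).
Hypothesis EP : forall a, D a -> Pr (E a) = p.
Hypothesis E_indep : forall a s, D a -> all D s -> all (fun b => ~~ ov a b) s ->
  Pr (E a `&` none_of s) = p * Pr (none_of s).
Hypothesis E_ov : forall a b, D a -> D b -> a != b -> ov a b ->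
  Pr (E a `&` E b) <= r.

(** Adding [E a] to the excluded events multiplies the probability that none of
    them occurs by [1 - p], up to [k * (r + p ^+ 2)]. Indeed [E a] is
    independent of the events that do not overlap it, and the at most [k] others
    can be left out twice: from [E a `&` none_of s] at the cost [k * r], and from
    [none_of s] at the cost [k * p], which is then multiplied by [p]. *)
Lemma none_of_estimate s : uniq s -> all D s ->
  (forall a, D a -> (count (ov a) s <= k)%N) ->
  `|Pr (none_of s) - (1 - p) ^+ size s| <= (size s)%:R * (k%:R * (r + p ^+ 2)).
Proof.
have /andP[p0 p1] := p_le1.
elim: s => [_ _ _|a s ih /= /andP[a_s us] /andP[Da Ds] ks].
  rewrite none_of_nil /Pr probability_setT /= expr0 subrr normr0.
  by rewrite mul0r.
have {}ih : `|Pr (none_of s) - (1 - p) ^+ size s| <=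
    (size s)%:R * (k%:R * (r + p ^+ 2)).
  apply: ih => // b Db; apply: leq_trans (ks b Db); exact: leq_addl.
have mN := measurable_none_of Ds.
have mEa := mE Da.
(* the events that overlap [E a], and the others *)
pose u := [seq b <- s | ov a b]; pose t := [seq b <- s | ~~ ov a b].
have Du : all D u by apply/allP => b; rewrite mem_filter => /andP[_ /(allP Ds)].
have Dt : all D t by apply/allP => b; rewrite mem_filter => /andP[_ /(allP Ds)].
have Nut : none_of (u ++ t) = none_of s.
  apply: none_of_mem => b; rewrite mem_cat !mem_filter -andb_orl.
  by rewrite orbN.
have uk : (size u <= k)%N.
  by rewrite size_filter; apply: leq_trans (ks a Da); exact: leq_addl.
have sz_r : (size u)%:R * r <= k%:R * r by rewrite ler_wpM2r ?ler_nat.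
have H1 := @none_of_cat_ge (E a) u t r mEa Du Dt.
have H2 := @none_of_cat_ge setT u t p measurableT Du Dt.
have {}H1 : Pr (E a `&` none_of t) <= Pr (E a `&` none_of s) + k%:R * r.
  rewrite -Nut; apply: le_trans (H1 _) _ => [b|]; last by rewrite lerD2l.
  rewrite mem_filter => /andP[ab bs]; apply: E_ov => //.
    exact: (allP Ds).
  by apply: contraNneq a_s => ->.
have {}H2 : Pr (none_of t) <= Pr (none_of s) + k%:R * p.
  rewrite -Nut -[none_of t]setTI -[none_of (u ++ t)]setTI.
  apply: le_trans (H2 _) _ => [b|].
    by rewrite setTI => bu; rewrite EP// (allP Du).
  by rewrite lerD2l ler_wpM2r// ler_nat.
have NsNt : none_of s `<=` none_of t.
  by move=> w ws b; rewrite mem_filter => /andP[_]; exact: ws.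
have mNt := measurable_none_of Dt.
have H3 : Pr (E a `&` none_of s) <= Pr (E a `&` none_of t).
  by apply: Pr_le; [exact: measurableI|exact: measurableI|exact: setIS].
have H4 : Pr (none_of s) <= Pr (none_of t) by exact: Pr_le.
have H5 : Pr (E a `&` none_of t) = p * Pr (none_of t).
  by apply: E_indep => //; apply/allP => b; rewrite mem_filter => /andP[].
have step : `|Pr (E a `&` none_of s) - p * Pr (none_of s)| <=
    k%:R * (r + p ^+ 2).
  rewrite ler_norml; apply/andP; split.
    have := ler_wpM2l p0 H4.
    have : 0 <= k%:R * p ^+ 2 by rewrite mulr_ge0 ?sqr_ge0.
    by rewrite mulrDr; lra.
  have := ler_wpM2l p0 H2.
  have : 0 <= k%:R * r by rewrite mulr_ge0.
  rewrite mulrDr [k%:R * (_ + _)]mulrDr expr2 mulrCA; lra.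
have mEaN : Pr (none_of (a :: s)) = Pr (none_of s) - Pr (E a `&` none_of s).
  by rewrite none_of_cons (Pr_split mN mEa) (setIC (E a)); ring.
rewrite mEaN exprS -natr1 [(_ + 1) * _]mulrDl mul1r.
rewrite (_ : _ - _ - _ = (1 - p) * (Pr (none_of s) - (1 - p) ^+ size s) -
   (Pr (E a `&` none_of s) - p * Pr (none_of s))); last by ring.
apply: (le_trans (ler_normB _ _)); apply: lerD => //.
rewrite normrM ger0_norm ?subr_ge0//; apply: le_trans ih.
by rewrite ler_piMl// gerBl.
Qed.

End no_event.

(** * Events about pairs of independent points *)

Section pairs_below.

Definition pairs_below n : seq (nat * nat) :=
  [seq (i, j) | j <- iota 0 n, i <- iota 0 j].

Lemma mem_pairs_below n i j : ((i, j) \in pairs_below n) = (i < j < n)%N.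
Proof.
apply/allpairsPdep/idP => [[y [x []]]|/andP[ij jn]].
  by rewrite !mem_iota /= !add0n => yn xy [-> ->]; rewrite xy yn.
by exists j, i; rewrite !mem_iota /= !add0n ij jn.
Qed.

Lemma uniq_pairs_below n : uniq (pairs_below n).
Proof.
apply: allpairs_uniq_dep => [|j _|]; try exact: iota_uniq.
by move=> [x y] [x' y'] _ _ /= [-> ->].
Qed.

Lemma size_pairs_below n : size (pairs_below n) = 'C(n, 2).
Proof.
rewrite size_allpairs_dep -bin2_sum sumnE big_map /index_iota subn0.
by apply: eq_bigr => j _; rewrite size_iota.
Qed.

Definition overlap (a b : nat * nat) :=
  [|| b.1 == a.1, b.1 == a.2, b.2 == a.1 | b.2 == a.2].

Lemma count_overlap n a : (count (overlap a) (pairs_below n) <= 4 * n)%N.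
Proof.
(* the pairs that have a given index at a given place *)
pose L := [seq (a.1, j) | j <- iota 0 n] ++ [seq (a.2, j) | j <- iota 0 n] ++
  [seq (i, a.1) | i <- iota 0 n] ++ [seq (i, a.2) | i <- iota 0 n].
have -> : (4 * n = size L)%N by rewrite !size_cat !size_map !size_iota; ring.
rewrite -size_filter; apply: uniq_leq_size.
  by rewrite filter_uniq// uniq_pairs_below.
move=> [i j]; rewrite mem_filter mem_pairs_below => /andP[aij /andP[ij jn]].
have i_n := ltn_trans ij jn.
rewrite !mem_cat; move: aij => /or4P[] /= /eqP <-; apply/or4P;
  [apply: Or41|apply: Or42|apply: Or43|apply: Or44];
  by apply: map_f; rewrite mem_iota.
Qed.

End pairs_below.

Section pair_events.
Local Open Scope ereal_scope.
Context d d' (T : measurableType d) (T' : measurableType d') (R : realType).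
Variables (P : probability T R) (X : nat -> {RV P >-> T'}).
Hypothesis X_indep : mutually_independent X.
Variable mu : probability T' R.
Hypothesis X_law : forall i A, measurable A -> P (X i @^-1` A) = mu A.

Lemma joint_law i j : i != j -> forall M, measurable M ->
  P (joint X i j @^-1` M) = (mu \x mu) M.
Proof.
move=> ij M mM.
rewrite (product_measure_unique (m' := image_measure P (measurable_joint X i j)))//.
move=> A B mA mB; rewrite -[RHS]/(mu A * mu B) -(X_law i mA) -(X_law j mB).
rewrite -(@sigma_of_indep _ _ _ _ _ _ X X_indep [fset i]%fset [fset j]%fset)//.
- by rewrite fdisjoint1X inE.
- by apply: sigma_of_X; rewrite ?inE.
- by apply: sigma_of_X; rewrite ?inE.
Qed.

(** So that [distribution P (joint X i j)] is a probability. *)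
HB.instance Definition _ i j :=
  isMeasurableFun.Build _ _ _ _ (joint X i j) (measurable_joint X i j).

Lemma joint3_law i j k : k != i -> k != j ->
  forall M : set ((T' * T') * T'), measurable M ->
  P ((fun w => (joint X i j w, X k w)) @^-1` M) =
  (distribution P (joint X i j) \x mu) M.
Proof.
move=> ki kj M mM.
have mJ : measurable_fun setT (fun w => (joint X i j w, X k w)).
  by apply: measurable_fun_pair; [exact: measurable_joint|exact: measurable_funP].
rewrite (product_measure_unique (m' := image_measure P mJ))//.
move=> A B mA mB.
rewrite -[RHS]/(P (joint X i j @^-1` A) * mu B) -(X_law k mB).
rewrite -(@sigma_of_indep _ _ _ _ _ _ X X_indep [fset i; j]%fset [fset k]%fset)//.
- by rewrite fdisjoint_sym fdisjoint1X !inE negb_or ki.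
- by apply: sigma_of_joint; rewrite ?inE ?eqxx ?orbT.
- by apply: sigma_of_X; rewrite ?inE.
Qed.

Variable H : set (T' * T').
Hypothesis mH : measurable H.
Hypothesis H_sym : forall x y, H (x, y) -> H (y, x).
Variable Q : R.
Hypothesis H_le : forall x, mu [set y | H (x, y)] <= Q%:E.

Definition pair_event (a : nat * nat) : set T := joint X a.1 a.2 @^-1` H.

Lemma measurable_pair_event a : measurable (pair_event a).
Proof.
rewrite -[X in measurable X]setTI; apply: measurable_joint => //.
Qed.

Lemma pair_eventC i j : pair_event (i, j) = pair_event (j, i).
Proof. by apply/seteqP; split => w; exact: H_sym. Qed.

Definition pair_prob : R := Pr (mu \x mu) H.

Lemma pair_probE : (mu \x mu) H = pair_prob%:E.
Proof. by rewrite PrE. Qed.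

Lemma measurable_slice d1 d2 (T1 : measurableType d1) (T2 : measurableType d2)
    (x : T1) (A : set (T1 * T2)) : measurable A -> measurable [set y | A (x, y)].
Proof.
move=> mA; have : measurable_fun setT (fun y : T2 => (x, y)).
  by apply: measurable_fun_pair.
by move=> /(_ measurableT _ mA); rewrite setTI.
Qed.

Lemma measurable_section d1 d2 (T1 : measurableType d1) (T2 : measurableType d2)
    (m : probability T2 R) (A : set (T1 * T2)) : measurable A ->
  measurable_fun setT (fun x => m [set y | A (x, y)]).
Proof.
move=> mA; rewrite (_ : (fun x => _) = m \o xsection A).
  exact: measurable_fun_xsection.
apply/funext => x /=; congr (m _); rewrite /xsection.
by apply/seteqP; split => y /=; rewrite inE.
Qed.

Lemma pair_prob_ge0 : (0 <= pair_prob)%R.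
Proof. exact: fine_ge0. Qed.

Lemma pair_prob_leQ : (pair_prob <= Q)%R.
Proof.
rewrite -lee_fin -pair_probE product_measure_set1.
apply: (@le_trans _ _ (\int[mu]_x (cst Q%:E) x)).
  apply: ge0_le_integral => //; first exact: measurable_section.
  by move=> x _; exact: H_le.
by rewrite integral_cst// -[X in _ * X]/(mu setT) probability_setT mule1.
Qed.

Lemma Pr_pair_event i j : i != j -> Pr P (pair_event (i, j)) = pair_prob.
Proof. by move=> ij; rewrite /Pr /pair_event joint_law. Qed.

(** Given [X i], the events of the pairs [i, j] and [i, k] are independent and
    have conditional probability at most [Q]. *)
Lemma Pr_pair_event_star i j k : i != j -> k != i -> k != j ->
  (Pr P (pair_event (i, j) `&` pair_event (i, k)) <= Q * pair_prob)%R.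
Proof.
move=> ij ki kj.
pose nu := distribution P (joint X i j).
pose M : set ((T' * T') * T') := [set z | H z.1 /\ H (z.1.1, z.2)].
have mM : measurable M.
  apply: measurableI.
    rewrite -[X in measurable X]setTI.
    exact: (measurable_fst (T1 := (T' * T')%type)).
  rewrite -[X in measurable X]setTI.
  have : measurable_fun setT (fun z : (T' * T') * T' => (z.1.1, z.2)).
    by apply: measurable_fun_pair => //=; apply: measurableT_comp.
  by apply.
have -> : pair_event (i, j) `&` pair_event (i, k) =
  (fun w => (joint X i j w, X k w)) @^-1` M by [].
rewrite -lee_fin -PrE; last first.
  rewrite -[X in measurable X]setTI.
  have : measurable_fun setT (fun w => (joint X i j w, X k w)).
    by apply: measurable_fun_pair; [exact: measurable_joint|exact: measurable_funP].
  by apply.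
rewrite joint3_law// product_measure_set1.
have Q0 : (0 <= Q)%R by exact: le_trans pair_prob_ge0 pair_prob_leQ.
apply: (@le_trans _ _ (\int[nu]_z (Q%:E * (\1_H z)%:E))); last first.
  rewrite ge0_integralZl_EFin//; last exact/measurable_EFinP/measurable_indic.
  rewrite integral_indic// setIT EFinM lee_wpmul2l ?lee_fin//.
  by rewrite -pair_probE -(joint_law ij mH).
apply: ge0_le_integral => //.
- exact: measurable_section.
- by apply: measurable_funeM; apply/measurable_EFinP; exact: measurable_indic.
- move=> z _; rewrite /M /= indicE.
  have [zH|zH] := boolP (z \in H).
    rewrite mule1; apply: le_trans (H_le z.1); apply: le_measure; rewrite ?inE.
    + exact: (measurable_slice z mM).
    + exact: measurable_slice.
    + by move=> y [].
  rewrite mule0 (_ : [set y | _] = set0) ?measure0//.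
  by apply/seteqP; split => y // [/mem_set]; rewrite (negPf zH).
Qed.

Definition ordered_pair : pred (nat * nat) := fun a => (a.1 < a.2)%N.

Lemma pair_event_indep a s : ordered_pair a -> all ordered_pair s ->
  all (fun b => ~~ overlap a b) s ->
  Pr P (pair_event a `&` none_of pair_event s) =
  (pair_prob * Pr P (none_of pair_event s))%R.
Proof.
case: a => [i j]; rewrite /ordered_pair /= => ij os nov.
pose S := [fset i; j]%fset.
pose S' := ([fset x in map fst s] `|` [fset x in map snd s])%fset.
have sS : sigma_of X S (pair_event (i, j)).
  by apply: sigma_of_joint; rewrite ?inE ?eqxx ?orbT.
have sS' : sigma_of X S' (none_of pair_event s).
  pose D' : pred (nat * nat) := fun b => (b.1 \in S') && (b.2 \in S').
  apply: (@measurable_none_of _ (g_sigma_algebraType (rectangles X S')) _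
    pair_event D').
    by move=> b /andP[b1 b2]; exact: sigma_of_joint.
  apply/allP => b bs; rewrite /D' !inE /=.
  by rewrite !map_f ?orbT.
have SS' : [disjoint S & S']%fset.
  apply/fdisjointP => x; rewrite !inE => xij; apply/negP => /orP[] /=;
    move=> /mapP[b bs xb]; have := allP nov _ bs; rewrite /overlap /= -xb;
    by move: xij => /orP[/eqP->|/eqP->]; rewrite eqxx ?orbT.
rewrite /Pr (sigma_of_indep X_indep SS' sS sS') fineM ?fin_num_measure//.
- by have /Pr_pair_event <- : i != j by rewrite ltn_eqF.
- exact: sigma_of_measurable sS.
- exact: sigma_of_measurable sS'.
Qed.

Lemma pair_event_overlap a b : ordered_pair a -> ordered_pair b -> a != b ->
  overlap a b -> (Pr P (pair_event a `&` pair_event b) <= Q * pair_prob)%R.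
Proof.
case: a b => [i j] [k l]; rewrite /ordered_pair /= => ij kl ab.
move=> /or4P[] /= /eqP e; move: ab kl; rewrite e.
- rewrite xpair_eqE eqxx /= eq_sym => lj il; apply: Pr_pair_event_star => //.
  + by rewrite ltn_eqF.
  + by rewrite gtn_eqF.
- move=> _ jl; rewrite (pair_eventC i j); apply: Pr_pair_event_star.
  + by rewrite gtn_eqF.
  + by rewrite gtn_eqF.
  + by rewrite gtn_eqF// (ltn_trans ij).
- move=> _ ki; rewrite (pair_eventC k i); apply: Pr_pair_event_star.
  + by rewrite ltn_eqF.
  + by rewrite ltn_eqF.
  + by rewrite ltn_eqF// (ltn_trans ki).
- rewrite xpair_eqE eqxx andbT => ik kj.
  rewrite (pair_eventC i j) (pair_eventC k j); apply: Pr_pair_event_star.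
  + by rewrite gtn_eqF.
  + by rewrite ltn_eqF.
  + by rewrite eq_sym.
Qed.

Lemma none_of_pairs_estimate n :
  (`|Pr P (none_of pair_event (pairs_below n)) - (1 - pair_prob) ^+ 'C(n, 2)|
   <= 'C(n, 2)%:R * ((4 * n)%:R * (Q * pair_prob + pair_prob ^+ 2)))%R.
Proof.
rewrite -size_pairs_below.
apply: (@none_of_estimate _ _ _ P _ pair_event ordered_pair _ overlap) => //.
- by move=> a _; exact: measurable_pair_event.
- by rewrite pair_prob_ge0 /= Pr_le1.
- by rewrite mulr_ge0 ?pair_prob_ge0// (le_trans pair_prob_ge0 pair_prob_leQ).
- by move=> [i j] ij; rewrite Pr_pair_event// ltn_eqF.
- exact: pair_event_indep.
- exact: pair_event_overlap.
- exact: uniq_pairs_below.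
- by apply/allP => -[i j]; rewrite mem_pairs_below => /andP[].
- by move=> a _; exact: count_overlap.
Qed.

End pair_events.

(** * The diameter of a convex hull *)

Section diameter.
Context {R : realType} {d : nat}.
Implicit Types (A : set 'rV[R]_d).

Lemma subset_convex_hull A : A `<=` convex_hull A.
Proof. exact: sub_gen_smallest. Qed.

Lemma convex_cball (z : 'rV[R]_d) (r : R) :
  convex_set ([set y | enorm (y - z) <= r] : set (convex_lmodType 'rV[R]_d)).
Proof.
move=> x y l /set_mem /= xr /set_mem /= yr; apply/mem_set => /=.
have l0 : 0 <= l%:num by [].
have l1 : 0 <= 1 - l%:num by rewrite subr_ge0.
have -> : conv l x y - z = l%:num *: (x - z) + (1 - l%:num) *: (y - z).
  rewrite -[conv l x y]/(l%:num *: x + (1 - l%:num) *: y).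
  by rewrite !scalerBr addrACA -opprD -scalerDl subrKC scale1r.
apply: (le_trans (enormD _ _)); rewrite !enormZ !ger0_norm//.
rewrite (_ : r = l%:num * r + (1 - l%:num) * r); last by ring.
by apply: lerD; exact: ler_wpM2l.
Qed.

(** Balls are convex: the bound extends to the hull in one variable, then in the
    other. *)
Lemma convex_hull_dist A (r : R) :
  (forall x y, A x -> A y -> enorm (x - y) <= r) ->
  forall x y, convex_hull A x -> convex_hull A y -> enorm (x - y) <= r.
Proof.
move=> Ar x y hx hy.
have step z : (forall y, A y -> enorm (y - z) <= r) ->
    forall y, convex_hull A y -> enorm (y - z) <= r.
  move=> Az; apply: smallest_sub; first exact: convex_cball.
  exact: Az.
apply: (step y _ x hx) => x' Ax'; rewrite enormB.
by apply: (step x' _ y hy) => y' Ay'; exact: Ar.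
Qed.

(** By [convex_hull_dist], the diameter of the hull is the largest distance of
    two of the points. *)
Lemma diam_convex_hull_ge (N : nat) (x : nat -> 'rV[R]_d) (r : R) :
  (0 < N)%N -> 0 < r ->
  r <= diam (convex_hull [set x i | i in `I_N]) <->
  exists i j, [/\ (i < j)%N, (j < N)%N & r <= enorm (x i - x j)].
Proof.
move=> N0 r0; set A := [set x i | i in `I_N].
pose D := \big[Num.max/0]_(i < N) \big[Num.max/0]_(j < N) enorm (x i - x j).
have le_D (i j : 'I_N) : enorm (x i - x j) <= D.
  exact: le_trans (le_bigmax _ (fun j : 'I_N => enorm (x i - x j)) j)
    (le_bigmax _ (fun i : 'I_N => \big[Num.max/0]_(j < N) enorm (x i - x j)) i).
have hD u v : convex_hull A u -> convex_hull A v -> enorm (u - v) <= D.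
  apply: convex_hull_dist => _ _ [i iN <-] [j jN <-].
  exact: (le_D (Ordinal iN) (Ordinal jN)).
have ubD : ubound [set enorm (u - v) | u in convex_hull A & v in convex_hull A] D.
  by move=> _ [u hu] [v hv] <-; exact: hD.
have Ax i : (i < N)%N -> convex_hull A (x i).
  by move=> iN; apply: subset_convex_hull; exists i.
split=> [rD|[i [j [ij jN rij]]]]; last first.
  apply: (le_trans rij); apply: ub_le_sup; first by exists D.
  exists (x i); first by apply: Ax; exact: ltn_trans ij jN.
  by exists (x j) => //; exact: Ax.
have {}rD : r <= D.
  apply: (le_trans rD); apply: ge_sup => //.
  by exists (enorm (x 0%N - x 0%N)); exists (x 0%N);
    [exact: Ax|exists (x 0%N) => //; exact: Ax].
apply: contrapT => H; suff : D < r by rewrite ltNge rD.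
apply/bigmax_ltP; split=> // i _; apply/bigmax_ltP; split=> // j _.
rewrite ltNge; apply/negP => rij; apply: H.
have [ij|ji|/val_inj ij] := ltngtP i j.
- by exists i, j; split.
- by exists j, i; split => //; rewrite enormB.
- by move: rij; rewrite ij subrr enorm0 leNgt r0.
Qed.

End diameter.

(** * Uniform points of the ball *)

Section uniform_points.
Local Open Scope ereal_scope.
Context (R : realType) (n : nat) (disp : measure_display).
Context (Omega : measurableType disp) (P : probability Omega R).
Variable xi : nat -> {RV P >-> 'rV[R]_n.+1}.
Hypothesis xi_indep : mutually_independent xi.
Hypothesis xi_unif : forall i, uniform_on unit_ball (xi i).
Local Notation lam := (@lebesgue_rV R n.+1).
Local Notation mu := (distribution P (xi 0%N)).

Lemma uniform_law A : measurable A ->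
  mu A = (ball_volume n.+1)^-1%:E * lam (A `&` unit_ball).
Proof.
move=> mA; rewrite (xi_unif 0%N mA) ball_volumeE inver.
by rewrite gt_eqF ?ball_volume_gt0// muleC.
Qed.

Lemma xi_law i A : measurable A -> P (xi i @^-1` A) = mu A.
Proof. by move=> mA; rewrite -[LHS]/(distribution P (xi i) A) !xi_unif. Qed.

(** Pairs outside the ball are discarded, so that [far_section_le] holds for all
    [x]; almost surely there are none. *)
Definition far_in_ball (s : R) : set ('rV[R]_n.+1 * 'rV[R]_n.+1) :=
  far_pairs (2 - s) `&` ball_pairs.

Lemma measurable_far_in_ball s : measurable (far_in_ball s).
Proof.
by apply: measurableI; [exact: measurable_far_pairs|exact: measurable_ball_pairs].
Qed.

Lemma far_in_ball_sym s x y : far_in_ball s (x, y) -> far_in_ball s (y, x).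
Proof.
rewrite /far_in_ball /far_pairs /ball_pairs /= enormB.
by move=> [? [? ?]]; split.
Qed.

Lemma product_uniform_law H : measurable H ->
  (mu \x mu) (H `&` ball_pairs) =
  (ball_volume n.+1 ^- 2)%:E * (lam \x lam) (H `&` ball_pairs).
Proof.
move=> mH; have mB := @measurable_ball_pairs R n.
have k0 : (0 <= (ball_volume n.+1 : R) ^- 2)%R.
  by rewrite invr_ge0 exprn_ge0// ball_volume_ge0.
pose m' : {measure set _ -> \bar R} :=
  mscale (NngNum k0) (mrestr (lam \x lam) mB).
have m'E A : m' A = (ball_volume n.+1 ^- 2)%:E * (lam \x lam) (A `&` ball_pairs).
  by [].
have mH' : measurable (H `&` ball_pairs) by exact: measurableI.
have -> : (mu \x mu) (H `&` ball_pairs) = m' (H `&` ball_pairs).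
  apply: product_measure_unique mH' => A B mA mB'.
  rewrite m'E /ball_pairs -setXI product_measure1E; last 2 first.
  - by apply: measurableI => //; exact: measurable_eball.
  - by apply: measurableI => //; exact: measurable_eball.
  rewrite -[RHS]/(mu A * mu B) !uniform_law// expr2 invfM EFinM.
  by rewrite !muleA; congr (_ * _); rewrite -!muleA; congr (_ * _); rewrite muleC.
by rewrite m'E -setIA setIid.
Qed.

Definition far_prob (s : R) : R := pair_prob mu (far_in_ball s).

(** Bound for the probability that a uniform point is far from a given one. *)
Definition far_section (s : R) : R :=
  (ball_volume n / ball_volume n.+1 * Num.sqrt 2 ^+ n *
    Num.sqrt (2 * s) ^+ n.+2)%R.

Lemma far_section_le s x : (0 < s)%R -> (s <= 1 / 2)%R ->
  mu [set y | far_in_ball s (x, y)] <= (far_section s)%:E.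
Proof.
move=> s0 s1; rewrite uniform_law; last first.
  exact: (measurable_slice x (measurable_far_in_ball s)).
have k0 := @ball_volume_gt0 R n.+1.
have [xB|xB] := leP (enorm x) 1%R; last first.
  rewrite (_ : _ `&` _ = set0) ?measure0 ?mule0 ?lee_fin.
    rewrite /far_section; apply: mulr_ge0; last by rewrite exprn_ge0 ?sqrtr_ge0.
    apply: mulr_ge0; last by rewrite exprn_ge0 ?sqrtr_ge0.
    by rewrite divr_ge0 ?ball_volume_ge0.
  apply/seteqP; split => y //= [[_ [/= + _]] _].
  by rewrite /unit_ball /= leNgt xB.
rewrite (_ : _ `&` _ =
    [set y | (2 - s <= enorm (x - y))%R /\ (enorm y <= 1)%R]); last first.
  apply/seteqP; split => y; rewrite /far_in_ball /far_pairs /ball_pairs /unit_ball /=.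
    by move=> [[? _] ?].
  by move=> [? ?].
apply: (@le_trans _ _ ((ball_volume n.+1)^-1%:E *
  (ball_volume n * Num.sqrt 2 ^+ n * Num.sqrt (2 * s) ^+ n.+2)%:E)).
  apply: lee_wpmul2l; first by rewrite lee_fin invr_ge0 ltW.
  exact: far_points_volume.
by rewrite -EFinM lee_fin /far_section le_eqVlt; apply/orP; left; apply/eqP; ring.
Qed.

Definition far_rate : R := (far_coef n / ball_volume n.+1 ^+ 2)%R.

Lemma far_prob_bounds s : (0 < s)%R -> (s <= 1 / 2)%R ->
  (far_rate * (Num.sqrt (2 - s / 2) * (1 - s / 2)) ^+ n
     * Num.sqrt (s / 2) ^+ n.+4 <= far_prob s
   <= far_rate * Num.sqrt 2 ^+ n * Num.sqrt (s / 2) ^+ n.+4)%R.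
Proof.
move=> s0 s1; rewrite -!lee_fin.
have mH := measurable_far_in_ball s.
rewrite -(pair_probE mu mH) product_uniform_law; last exact: measurable_far_pairs.
have a0 : (0 < 1 - s / 2)%R by lra.
have a1 : (1 - s / 2 < 1)%R by lra.
have k2 : 0 <= (ball_volume n.+1 ^- 2)%:E :> \bar R.
  by rewrite lee_fin invr_ge0 exprn_ge0// ball_volume_ge0.
have := far_pairs_volume_bounds n a0 a1.
rewrite (_ : 2 * (1 - s / 2) = 2 - s)%R; last by field.
rewrite (_ : 1 - (1 - s / 2) = s / 2)%R; last by ring.
rewrite (_ : 1 + (1 - s / 2) = 2 - s / 2)%R; last by ring.
move=> /andP[H1 H2]; apply/andP; split.
  apply: le_trans (lee_wpmul2l k2 H1); rewrite -EFinM lee_fin.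
  by rewrite le_eqVlt; apply/orP; left; apply/eqP; rewrite /far_rate exprMn; ring.
apply: le_trans (lee_wpmul2l k2 H2) _; rewrite -EFinM lee_fin.
by rewrite le_eqVlt; apply/orP; left; apply/eqP; rewrite /far_rate; ring.
Qed.

End uniform_points.

Section diameter_event.
Local Open Scope ereal_scope.
Context (R : realType) (n : nat) (disp : measure_display).
Context (Omega : measurableType disp) (P : probability Omega R).
Variable xi : nat -> {RV P >-> 'rV[R]_n.+1}.
Hypothesis xi_indep : mutually_independent xi.
Hypothesis xi_unif : forall i, uniform_on unit_ball (xi i).

(** Restricting the pairs to the ball changes the event by a null set. *)
Lemma diameter_event (N : nat) (s : R) : (0 < N)%N -> (s < 2)%R ->
  P [set w | (2 - s <= diam (convex_hull [set xi i w | i in `I_N]))%R] =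
  (1 - Pr P (none_of (pair_event xi (far_in_ball s)) (pairs_below N)))%:E.
Proof.
move=> N0 s2.
pose F := none_of (pair_event xi (far_pairs (2 - s))) (pairs_below N).
pose G := none_of (pair_event xi (far_in_ball s)) (pairs_below N).
pose Out := \bigcup_i (xi i @^-1` ~` unit_ball).
have mF : measurable F.
  apply: (measurable_none_of (D := xpredT)); last exact: all_predT.
  by move=> a _; apply: measurable_pair_event; exact: measurable_far_pairs.
have mG : measurable G.
  apply: (measurable_none_of (D := xpredT)); last exact: all_predT.
  by move=> a _; apply: measurable_pair_event; exact: measurable_far_in_ball.
have mB : measurable (~` unit_ball : set 'rV[R]_n.+1).
  by apply: measurableC; exact: measurable_eball.
have mXB i : measurable (xi i @^-1` ~` unit_ball) by exact: measurable_funPTI.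
have mOut : measurable Out by apply: bigcupT_measurable.
have Out0 : P Out = 0.
  apply: measure_negligible => //; apply: negligible_bigcup => i.
  apply/negligibleP => //.
  transitivity (P (xi i @^-1` ~` unit_ball)) => //.
  by rewrite (xi_law xi_unif)// (uniform_law xi_unif)// setICl measure0 mule0.
have FG : F `<=` G by move=> w Fw a aN [wa _]; exact: Fw aN wa.
have GF : G `<=` F `|` Out.
  move=> w Gw; have [ow|ow] := pselect (Out w); [by right|left].
  have inB i : unit_ball (xi i w).
    by apply: contrapT => h; apply: ow; exists i.
  by move=> a aN wa; apply: (Gw a aN); split => //; split; exact: inB.
have PrFG : Pr P F = Pr P G.
  apply/eqP; rewrite eq_le Pr_le//= -lee_fin -!PrE//.
  apply: (@le_trans _ _ (P (F `|` Out))).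
    by apply: le_measure; rewrite ?inE//; exact: measurableU.
  apply: (@le_trans _ _ (P F + P Out)); first exact: measureU2.
  by rewrite Out0 adde0.
rewrite -/G -PrFG EFinB -PrE// -probability_setC//; congr (P _).
apply/seteqP; split => w /=.
  move=> /(diam_convex_hull_ge (xi ^~ w) N0)[|i [j [ij jN rij]]].
    by rewrite subr_gt0.
  by move=> /(_ (i, j)); apply => //; rewrite mem_pairs_below ij.
move=> Fw; apply/diam_convex_hull_ge => //; first by rewrite subr_gt0.
apply: contrapT => H; apply: Fw => -[i j]; rewrite mem_pairs_below => /andP[ij jN].
by move=> wij; apply: H; exists i, j; split.
Qed.

End diameter_event.

Section limits.
Context (R : realType).

(** From [expR (- (p / (1 - p))) <= 1 - p <= expR (- p)]. *)
Lemma cvg_onem_expn (m : nat -> nat) (p : nat -> R) (l : R) :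
  (forall k, 0 <= p k) -> p @ \oo --> 0 ->
  (fun k => (m k)%:R * p k) @ \oo --> l ->
  (fun k => (1 - p k) ^+ m k) @ \oo --> expR (- l).
Proof.
move=> p0 cp cmp.
have expc : continuous (@expR R) by exact: continuous_expR.
apply: (@squeeze_cvgr _ _ _ _ (fun k => expR (- ((m k)%:R * p k / (1 - p k))))
  (fun k => expR (- ((m k)%:R * p k)))).
- near=> k; have pk1 : p k < 1.
    by near: k; exact: (cvgr_lt (0 : R) cp _ ltr01).
  have q0 : 0 < 1 - p k by rewrite subr_gt0.
  have E x : expR (- ((m k)%:R * x)) = expR (- x) ^+ m k.
    by rewrite -expRM_natl mulrN.
  rewrite -mulrA !E !lerXn2r ?nnegrE ?expR_ge0 ?(ltW q0)//=.
    by have := expR_ge1Dx (- p k); lra.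
  rewrite expRN -[leRHS]invrK lef_pV2 ?posrE ?expR_gt0 ?invr_gt0//.
  apply: le_trans (expR_ge1Dx _).
  by rewrite -subr_ge0 (_ : _ - _ = 0)//; field; rewrite gt_eqF.
- apply: (cvg_comp _ expR); last exact: expc.
  have c1 : (fun k => 1 - p k) @ \oo --> (1 : R).
    by rewrite -[X in _ --> X]subr0; apply: cvgB => //; exact: cvg_cst.
  have c2 : (fun k => (1 - p k)^-1) @ \oo --> (1 : R).
    by rewrite -[X in _ --> X]invr1; apply: cvgV => //.
  by apply: cvgN; rewrite -[X in _ --> X]mulr1; exact: cvgM.
- by apply: (cvg_comp _ expR); last exact: expc; exact: cvgN.
Unshelve. all: by end_near.
Qed.

Lemma cvg_div_powR (t a : R) : 0 < t -> 0 < a ->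
  (fun N : nat => t / N%:R `^ a) @ \oo --> 0.
Proof.
move=> t0 a0; apply/cvgr0Pnorm_lt => e e0.
near=> N.
have N0 : 0 < N%:R :> R.
  by rewrite (le_lt_trans (powR_ge0 (t / e) a^-1))//; near: N; exact: nbhs_infty_gtr.
rewrite ger0_norm ?divr_ge0 ?powR_ge0 ?(ltW t0)//.
rewrite ltr_pdivrMr ?powR_gt0// mulrC -ltr_pdivrMr//.
have -> : t / e = ((t / e) `^ a^-1) `^ a.
  by rewrite -powRrM mulVf ?gt_eqF// powRr1// divr_ge0 ?ltW.
apply: gt0_ltr_powR; rewrite ?nnegrE ?powR_ge0 ?(ltW N0)//.
by near: N; exact: nbhs_infty_gtr.
Unshelve. all: by end_near.
Qed.

End limits.

(** * Passage to the limit *)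

Section scaling.
Context (R : realType) (n : nat) (t : R).
Hypothesis t0 : 0 < t.

Definition gap (N : nat) : R := t / N%:R `^ (4 / (n.+1%:R + 3)).

Lemma gap_gt0 N : (0 < N)%N -> 0 < gap N.
Proof. by move=> N0; rewrite divr_gt0// powR_gt0// ltr0n. Qed.

Lemma cvg_gap : gap @ \oo --> 0.
Proof. by apply: cvg_div_powR => //; rewrite divr_gt0// addr_gt0. Qed.

Lemma cvg_sqrt_gap : (fun N => Num.sqrt (gap N)) @ \oo --> 0.
Proof.
rewrite -[X in _ --> X]sqrtr0; apply: (cvg_comp _ Num.sqrt) cvg_gap _.
exact: sqrt_continuous.
Qed.

(** The scale [gap N] is chosen so that the number [N ^ 2] of pairs compensates
    the probability, of order [gap N ^ ((d + 3) / 2)], that a pair is far. *)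
Lemma sqr_gap N : (0 < N)%N ->
  N%:R ^+ 2 * Num.sqrt (gap N) ^+ n.+4 = t `^ ((n.+1%:R + 3) / 2).
Proof.
move=> N0; have N0' : 0 < N%:R :> R by rewrite ltr0n.
have sN := gap_gt0 N0.
rewrite -powR12_sqrt ?ltW// -(powR_mulrn _ (powR_ge0 (gap N) 2^-1)) -powRrM.
have e0 : n.+1%:R + 3 != 0 :> R by rewrite gt_eqF// addr_gt0.
have -> : 2^-1 * n.+4%:R = (n.+1%:R + 3) / 2 :> R.
  by rewrite -(natrD _ n.+1 3) addn3 mulrC.
rewrite /gap -powRN powRM ?powR_ge0 ?(ltW t0)// -powRrM.
rewrite (_ : _ * ((n.+1%:R + 3) / 2) = - 2%:R); last by field.
by rewrite powR_invn ?(ltW N0')// mulrCA divff ?mulr1// expf_neq0// gt_eqF.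
Qed.

(** The order of the expected number of points far from a given one. Its square
    is a constant times [Num.sqrt (gap N) ^+ n], by [sqr_gap]. *)
Lemma cvg_far_points : (0 < n)%N ->
  (fun N => N%:R * Num.sqrt (gap N) ^+ n.+2) @ \oo --> 0.
Proof.
move=> n0; pose e : R := (n.+1%:R + 3) / 2.
have c0 : (fun N => Num.sqrt (gap N) ^+ n) @ \oo --> (0 : R).
  have -> : 0 = 0 ^+ n :> R by rewrite expr0n eqn0Ngt n0.
  apply: (cvg_comp _ (fun x : R => x ^+ n)) cvg_sqrt_gap _.
  exact: exprn_continuous.
have c1 : (fun N => t `^ e * Num.sqrt (gap N) ^+ n) @ \oo --> (0 : R).
  by rewrite -[X in _ --> X](mulr0 (t `^ e)); exact: cvgMr.
have c : (fun N => Num.sqrt (t `^ e * Num.sqrt (gap N) ^+ n)) @ \oo --> (0 : R).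
  rewrite -[X in _ --> X]sqrtr0; apply: (cvg_comp _ Num.sqrt) c1 _.
  exact: sqrt_continuous.
apply: cvg_trans c; apply: near_eq_cvg; near=> N.
have N0 : (0 < N)%N by near: N; exact: nbhs_infty_gt.
rewrite -(sqr_gap N0) -mulrA -exprD.
rewrite (_ : n.+4 + n = n.+2 * 2)%N; last by rewrite muln2 -addnn !addSn !addnS.
rewrite exprM -exprMn sqrtr_sqr ger0_norm// mulr_ge0// exprn_ge0 ?sqrtr_ge0//.
Unshelve. all: by end_near.
Qed.

End scaling.

Section poisson.
Context (R : realType) (n : nat) (disp : measure_display).
Context (Omega : measurableType disp) (P : probability Omega R).
Variable xi : nat -> {RV P >-> 'rV[R]_n.+1}.
Hypothesis xi_indep : mutually_independent xi.
Hypothesis xi_unif : forall i, uniform_on unit_ball (xi i).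
Variable t : R.
Hypotheses (n0 : (0 < n)%N) (t0 : 0 < t).
Local Notation gap := (gap n t).
Local Notation prob := (fun N => far_prob xi (gap N)).
Local Notation tau := (t `^ ((n.+1%:R + 3) / 2)).

Lemma near_gap : \forall N \near \oo,
  [/\ (0 < N)%N, 0 < gap N & gap N <= 1 / 2].
Proof.
near=> N.
have N0 : (0 < N)%N by near: N; exact: nbhs_infty_gt.
split => //; first exact: gap_gt0.
near: N; apply: (cvgr_le (0 : R) (cvg_gap n t0)).
by rewrite divr_gt0.
Unshelve. all: by end_near.
Qed.

Lemma far_prob_ge0 s : 0 <= far_prob xi s.
Proof. exact: pair_prob_ge0. Qed.

Lemma cvg_far_pairs :
  (fun N => N%:R ^+ 2 * prob N) @ \oo --> far_rate R n * tau / 4.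
Proof.
pose k : R := Num.sqrt 2^-1 ^+ n.+4.
have kE : Num.sqrt 2 ^+ n * k = 4^-1.
  rewrite /k -addn4 exprD mulrA -exprMn -sqrtrM// divff// sqrtr1 expr1n mul1r.
  rewrite (exprM _ 2 2) sqr_sqrtr//; by field.
have hE N : (0 < N)%N ->
    N%:R ^+ 2 * Num.sqrt (gap N / 2) ^+ n.+4 = tau * k.
  move=> N0; rewrite -(sqr_gap n t0 N0) sqrtrM ?(ltW (gap_gt0 n t0 N0))//.
  by rewrite exprMn mulrA.
have cs : (fun N => gap N / 2) @ \oo --> (0 : R).
  by rewrite -[X in _ --> X](mul0r 2^-1); apply: cvgMl; exact: cvg_gap.
apply: (@squeeze_cvgr _ _ _ _
  (fun N => far_rate R n * (Num.sqrt (2 - gap N / 2) * (1 - gap N / 2)) ^+ n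
    * (tau * k)) (fun N => far_rate R n * Num.sqrt 2 ^+ n * (tau * k))).
- near=> N.
  have [N0 s0 s1] : [/\ (0 < N)%N, 0 < gap N & gap N <= 1 / 2].
    by near: N; exact: near_gap.
  have /andP[H1 H2] := far_prob_bounds xi_unif s0 s1.
  have N2 : 0 <= N%:R ^+ 2 :> R by rewrite exprn_ge0.
  rewrite -(hE N N0) ![_ * (N%:R ^+ 2 * _)]mulrCA.
  by apply/andP; split; apply: ler_wpM2l.
- rewrite (_ : _ / 4 = far_rate R n * (Num.sqrt (2 - 0) * (1 - 0)) ^+ n * (tau * k));
    last by rewrite !subr0 mulr1 -[in LHS]kE; ring.
  apply: cvgMl; apply: cvgMr.
  apply: (cvg_comp _ (fun x : R => x ^+ n)); last exact: exprn_continuous.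
  apply: cvgM; last by apply: cvgB => //; exact: cvg_cst.
  apply: (cvg_comp _ Num.sqrt); last exact: sqrt_continuous.
  by apply: cvgB => //; exact: cvg_cst.
- rewrite (_ : _ / 4 = far_rate R n * Num.sqrt 2 ^+ n * (tau * k)).
    exact: cvg_cst.
  by rewrite -[in LHS]kE; ring.
Unshelve. all: by end_near.
Qed.

Lemma cvg_far_section : (fun N => N%:R * far_section n (gap N)) @ \oo --> 0.
Proof.
pose k : R := ball_volume n / ball_volume n.+1 * Num.sqrt 2 ^+ n *
  Num.sqrt 2 ^+ n.+2.
have c : (fun N => k * (N%:R * Num.sqrt (gap N) ^+ n.+2)) @ \oo --> k * 0.
  by apply: cvgMr; exact: cvg_far_points.
rewrite -[X in _ --> X](mulr0 k); apply: cvg_trans c; apply: near_eq_cvg; near=> N.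
by rewrite /far_section [Num.sqrt (2 * gap N)]sqrtrM// exprMn /k; ring.
Unshelve. all: by end_near.
Qed.

Lemma cvg_invn : (fun N : nat => N%:R^-1 : R) @ \oo --> 0.
Proof.
apply/cvgr0Pnorm_lt => e e0; near=> N.
have N0 : e^-1 < N%:R by near: N; exact: nbhs_infty_gtr.
have N1 : 0 < N%:R :> R by apply: lt_trans N0; rewrite invr_gt0.
by rewrite ger0_norm ?invr_ge0 ?ltW// -[e]invrK ltf_pV2 ?posrE ?invr_gt0.
Unshelve. all: by end_near.
Qed.

Lemma cvg_far_prob : prob @ \oo --> 0.
Proof.
have c : (fun N => N%:R^-1 * N%:R^-1 * (N%:R ^+ 2 * prob N)) @ \oo -->
    0 * 0 * (far_rate R n * tau / 4).
  by apply: cvgM; [apply: cvgM; exact: cvg_invn|exact: cvg_far_pairs].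
rewrite !mul0r in c; apply: cvg_trans c; apply: near_eq_cvg; near=> N.
have N0 : N%:R != 0 :> R.
  by rewrite pnatr_eq0 -lt0n; near: N; exact: nbhs_infty_gt.
by rewrite /=; field.
Unshelve. all: by end_near.
Qed.

Lemma cvg_mean_pairs :
  (fun N => 'C(N, 2)%:R * prob N) @ \oo --> far_rate R n * tau / 8.
Proof.
have c : (fun N : nat => (1 - N%:R^-1) / 2 : R) @ \oo --> ((1 - 0) / 2 : R).
  apply: cvgMl.
  by apply: cvgB; [exact: cvg_cst|exact: cvg_invn].
have c2 : (fun N => (1 - N%:R^-1) / 2 * (N%:R ^+ 2 * prob N)) @ \oo -->
    (1 - 0) / 2 * (far_rate R n * tau / 4).
  by apply: cvgM; [exact: c|exact: cvg_far_pairs].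
rewrite (_ : _ / 8 = (1 - 0) / 2 * (far_rate R n * tau / 4)); last by field.
apply: cvg_trans c2; apply: near_eq_cvg; near=> N.
have N0 : (0 < N)%N by near: N; exact: nbhs_infty_gt.
have N0' : N%:R != 0 :> R by rewrite pnatr_eq0 -lt0n.
have E : 'C(N, 2)%:R * 2 = N%:R * (N%:R - 1) :> R.
  rewrite -natrM -[(N%:R - 1)]/(N%:R - 1%:R) -natrB// -natrM bin2 muln2.
  by rewrite halfK subn1 oddM; case: (N) N0 => // m _ /=; rewrite andNb subn0.
rewrite /=; apply: (mulIf (_ : 2 != 0)) => //.
rewrite [RHS]mulrAC E; field.
exact: N0'.
Unshelve. all: by end_near.
Qed.

(** The error in [none_of_pairs_estimate] is bounded by the expected number of
    far pairs, which converges, times a bound for the expected number of points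
    far from a given one, which vanishes. *)
Lemma cvg_no_far_pair :
  (fun N => Pr P (none_of (pair_event xi (far_in_ball (gap N))) (pairs_below N)))
    @ \oo --> expR (- (far_rate R n * tau / 8)).
Proof.
apply: cvg_sub0 (cvg_onem_expn (fun N => far_prob_ge0 _) cvg_far_prob cvg_mean_pairs).
apply/norm_cvg0P.
have c : (fun N => 8 * (N%:R ^+ 2 * prob N) * (N%:R * far_section n (gap N)))
    @ \oo --> 0.
  rewrite -[X in _ --> X](mulr0 (8 * (far_rate R n * tau / 4))).
  by apply: cvgM; [apply: cvgMr; exact: cvg_far_pairs|exact: cvg_far_section].
apply: (@squeeze_cvgr _ _ _ _ (fun=> 0)
  (fun N => 8 * (N%:R ^+ 2 * prob N) * (N%:R * far_section n (gap N)))) => //.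
  near=> N; apply/andP; split; first exact: normr_ge0.
  have [N0 s0 s1] : [/\ (0 < N)%N, 0 < gap N & gap N <= 1 / 2].
    by near: N; exact: near_gap.
  have mH := @measurable_far_in_ball R n (gap N).
  have H_le := far_section_le xi_unif _ s0 s1.
  have pQ := pair_prob_leQ mH H_le.
  have := none_of_pairs_estimate xi_indep (xi_law xi_unif) mH
    (@far_in_ball_sym _ _ _) H_le N.
  move=> /le_trans; apply; rewrite -[pair_prob _ _]/(far_prob xi (gap N)).
  have {}pQ : prob N <= far_section n (gap N) by [].
  have p0 := far_prob_ge0 (gap N).
  move: (far_prob xi (gap N)) (far_section n (gap N)) p0 pQ => p Q p0 pQ.
  have CN : 'C(N, 2)%:R <= N%:R ^+ 2 :> R.
    rewrite -natrX ler_nat bin2 -divn2 (leq_trans (leq_div _ _))//.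
    by rewrite -mulnn leq_mul// leq_pred.
  have pp : p ^+ 2 <= Q * p by rewrite expr2 ler_wpM2r.
  rewrite (_ : 8 * _ * _ = N%:R ^+ 2 * ((4 * N)%:R * (Q * p + Q * p))); last first.
    by rewrite natrM; ring.
  apply: ler_pM => //.
    by rewrite mulr_ge0// addr_ge0 ?sqr_ge0// mulr_ge0// (le_trans p0).
  by apply: ler_wpM2l => //; rewrite lerD2l.
exact: cvg_cst.
Unshelve. all: by end_near.
Qed.

End poisson.

(** By [ball_volume_Gamma] in the dimensions [n] and [n + 1]. *)
Lemma far_rateE (R : realType) (n : nat) :
  far_rate R n / 8 = 2 ^+ n.+1 * n.+1%:R * Gamma (n.+1%:R / 2 + 1) /
    (Num.sqrt pi * (n.+1%:R + 1) * (n.+1%:R + 3) * Gamma ((n.+1%:R + 1) / 2)).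
Proof.
have G1 := @ball_volume_Gamma R n; have G2 := @ball_volume_Gamma R n.+1.
have pi0 : Num.sqrt pi != 0 :> R by rewrite gt_eqF// sqrtr_gt0 pi_gt0.
rewrite (_ : (n.+1%:R + 1) / 2 = n%:R / 2 + 1 :> R); last first.
  by rewrite -natr1; field.
have k1 := @ball_volume_gt0 R n; have k2 := @ball_volume_gt0 R n.+1.
have g1 : Gamma (n%:R / 2 + 1) != 0 :> R.
  apply/eqP => g0; move: G1; rewrite g0 mulr0 => /esym/eqP.
  by rewrite expf_eq0 (negPf pi0) andbF.
have -> : Gamma (n.+1%:R / 2 + 1) = Num.sqrt pi ^+ n.+1 / ball_volume n.+1 :> R.
  by rewrite -G2 mulrAC divff ?mul1r// gt_eqF.
have -> : Gamma (n%:R / 2 + 1) = Num.sqrt pi ^+ n / ball_volume n :> R.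
  by rewrite -G1 mulrAC divff ?mul1r// gt_eqF.
rewrite /far_rate /far_coef.
have -> : n.+2%:R = n.+1%:R + 1 :> R by rewrite natr1.
have -> : n.+4%:R = n.+1%:R + 3 :> R by rewrite -natrD addn3.
have d0 : 0 < n.+1%:R :> R by [].
move: (n.+1%:R : R) d0 => d d0.
rewrite [2 ^+ n.+2]exprS (exprS (Num.sqrt pi)).
have s0 : Num.sqrt pi ^+ n != 0 :> R by rewrite expf_neq0.
field.
by rewrite s0 pi0 !gt_eqF// addr_gt0.
Qed.

Theorem theorem1p1 (R : realType) (d : nat) (hd : (2 <= d)%N)
    (disp : measure_display) (Omega : measurableType disp)
    (P : probability Omega R) (xi : nat -> {RV P >-> 'rV[R]_d})
    (xi_indep : mutually_independent xi)
    (xi_unif : forall i, uniform_on unit_ball (xi i))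
    (t : R) (ht : 0 < t) :
  (fun n : nat => P [set w | n%:R `^ (4 / (d%:R + 3)) *
      (2 - diam (convex_hull [set xi i w | i in `I_n])) <= t])
    @ \oo -->
  (1 - expR (- (2 ^+ d * d%:R * Gamma (d%:R / 2 + 1) /
                 (Num.sqrt pi * (d%:R + 1) * (d%:R + 3)
                   * Gamma ((d%:R + 1) / 2))
               * t `^ ((d%:R + 3) / 2))))%:E.
Proof.
case: d hd xi xi_indep xi_unif => [//|n] n0 xi xi_indep xi_unif.
have n_gt0 : (0 < n)%N by [].
have c := cvg_no_far_pair xi_indep xi_unif n_gt0 ht.
pose q N := 1 - Pr P (none_of (pair_event xi (far_in_ball (gap n t N)))
  (pairs_below N)).
have cq : (fun N => (q N)%:E) @ \oo -->
    (1 - expR (- (far_rate R n * t `^ ((n.+1%:R + 3) / 2) / 8)))%:E.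
  apply: cvg_EFin; first by near=> N.
  by apply: cvgB; [exact: cvg_cst|exact: c].
rewrite -far_rateE [far_rate R n / 8 * _]mulrAC.
apply: cvg_trans cq; apply: near_eq_cvg; near=> N.
have [N0 s0 s1] : [/\ (0 < N)%N, 0 < gap n t N & gap n t N <= 1 / 2].
  by near: N; exact: near_gap.
have s2 : gap n t N < 2 by lra.
have p0 : 0 < N%:R `^ (4 / (n.+1%:R + 3)) :> R by rewrite powR_gt0// ltr0n.
rewrite /= -(diameter_event xi_unif N0 s2); congr (P _).
apply/seteqP; split => w /=; rewrite lerBlDr -lerBlDl /gap ler_pdivlMr// mulrC.
Unshelve. all: by end_near.
Qed.
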